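(* Let $P\in\mathbb{Z}[x]\setminus\{0\}$ have degree at most three, and let $R$ be its squarefree radical over $\mathbb{Q}$, represented primitively in $\mathbb{Z}[x]$. Then $P$ is intersective if and only if one of the following alternatives holds. (i) The polynomial $R$ splits over $\mathbb{Q}$ and, on writing $$R(x)=\pm\prod_{i=1}^r(a_ix+b_i),\qquad 1\le r\le 3,$$ with each factor primitive in $\mathbb{Z}[x]$, one has $\gcd(|a_1|,\ldots,|a_r|)=1$. (ii) The polynomial $R$ has degree three and $R(x)=\pm L(x)Q(x)$ with $L(x)=ax+b$, where $L\in\mathbb{Z}[x]$ is primitive and $Q\in\mathbb{Z}[x]$ is primitive and irreducible quadratic; and for every prime $p\mid a$, the polynomial $Q$ has a root in $\mathbb{Z}_p$. The test in (ii) is finite: if $s_p=v_p\bigl(|\mathrm{Res}(Q,Q')|\bigr)$, then its local condition is equivalent to the solvability of $$Q(x)\equiv 0\pmod{p^{2s_p+1}}$$ for every prime $p\mid a$.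
   Context: A polynomial $H\in\mathbb{Z}[x]$ is intersective if for every integer $m\ge 1$ there exists $n\in\mathbb{Z}$ with $H(n)\equiv 0\pmod m$. The squarefree radical over $\mathbb{Q}$ of a nonzero $P\in\mathbb{Z}[x]$, represented primitively in $\mathbb{Z}[x]$, is (up to sign) the product of the pairwise nonassociate nonconstant primitive irreducible factors of $P$ in $\mathbb{Z}[x]$, each taken once (the empty product being $1$). $\mathrm{Res}$ denotes the resultant, $v_p$ the $p$-adic valuation, and $\mathbb{Z}_p$ the ring of $p$-adic integers. *)

(* Defs.v *)
From HB Require Import structures.
From mathcomp Require Import all_boot all_order all_algebra.
From mathcomp Require Import boolp.

Set Implicit Arguments.
Unset Strict Implicit.
Unset Printing Implicit Defensive.

Import Order.TTheory GRing.Theory Num.Theory.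
Local Open Scope ring_scope.

Definition intersective (H : {poly int}) : Prop :=
  forall m : nat, (0 < m)%N -> exists n : int, (H.[n] = 0 %[mod m])%Z.

(* zcontents carries the sign of the leading coefficient. *)
Definition primitive_polyZ (f : {poly int}) : bool := `|zcontents f|%N == 1%N.

(* Irreducibility in the ring Z[x]; the library's irreducible_poly relies on
   pseudo-division, so over int it ignores constant factors. *)
Definition irreducible_polyZ (f : {poly int}) : Prop :=
  [/\ f != 0, f \isn't a GRing.unit
    & forall g h : {poly int}, f = g * h ->
        g \is a GRing.unit \/ h \is a GRing.unit].

(* The units of Z[x] being 1 and -1, this is also the relation "associate". *)
Definition eq_upto_sign (f g : {poly int}) : bool := (f == g) || (f == - g).

(* Divisibility is taken in Z[x]: over int, %| only means divisibility in
   Q[x]. *)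
Definition radical_factor (P f : {poly int}) : Prop :=
  [/\ (1 < size f)%N, primitive_polyZ f, irreducible_polyZ f
    & exists g : {poly int}, P = f * g].

Definition squarefree_radical (P R : {poly int}) : Prop :=
  exists s : seq {poly int},
    [/\ forall f, f \in s -> radical_factor P f,
        pairwise (fun f g => ~~ eq_upto_sign f g) s,
        forall f, radical_factor P f -> exists2 g, g \in s & eq_upto_sign f g
      & eq_upto_sign R (\prod_(f <- s) f)].

Definition splits_over_rat (f : {poly int}) : Prop :=
  exists rs : seq rat,
    (map_poly intr f : {poly rat}) %= \prod_(z <- rs) ('X - z%:P).

Definition linear_polyZ (a b : int) : {poly int} := a *: 'X + b%:P.

(* The p-adic integers, as the inverse limit of the rings Z / p^k Z. An element
   is the sequence of its residues; the coherence condition also forces the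
   k-th residue to lie in [0, p^k). As for 'Z_p, the base is max p 2, so that
   the ring is always nontrivial. *)

Section PadicInt.
Variable p : nat.

Definition padic_modulus (k : nat) : int := (Zp_trunc p).+2%:Z ^+ k.
Local Notation M := padic_modulus.

Definition padic_coherent (x : nat -> int) : bool :=
  `[< forall k, x k = (x k.+1 %% M k)%Z >].

Record padic_int := PadicInt {
  padic_residue :> nat -> int;
  padic_residueP : padic_coherent padic_residue }.

HB.instance Definition _ := [isSub for padic_residue].
HB.instance Definition _ := [Choice of padic_int by <:].

Lemma padic_residue_mod (x : padic_int) k : (x k %% M k)%Z = x k.
Proof. by have /asboolP xP := padic_residueP x; rewrite xP modz_mod. Qed.

Lemma padic_ext (x y : padic_int) :
  (forall k, (x k = y k %[mod M k])%Z) -> x = y.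
Proof.
move=> exy; apply: val_inj; apply/funext => k /=.
by rewrite -padic_residue_mod exy padic_residue_mod.
Qed.

Lemma padic_reduce_subproof (f : nat -> int) :
    (forall k, (f k = f k.+1 %[mod M k])%Z) ->
  padic_coherent (fun k => (f k %% M k)%Z).
Proof.
move=> fP; apply/asboolP => k; rewrite fP {1}(divz_eq (f k.+1) (M k.+1)).
by rewrite /padic_modulus exprS mulrA modzMDl.
Qed.

Definition padic_reduce f fP := PadicInt (@padic_reduce_subproof f fP).

Lemma padic_coh (x : padic_int) k : (x k = x k.+1 %[mod M k])%Z.
Proof. by have /asboolP xP := padic_residueP x; rewrite xP modz_mod. Qed.

Fact padic_cst_subproof (n : int) k : (n = n %[mod M k])%Z.
Proof. by []. Qed.

Fact padic_opp_subproof (x : padic_int) k : (- x k = - x k.+1 %[mod M k])%Z.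
Proof. by rewrite -modzNm padic_coh modzNm. Qed.

Fact padic_add_subproof (x y : padic_int) k :
  (x k + y k = x k.+1 + y k.+1 %[mod M k])%Z.
Proof. by rewrite -modzDm !padic_coh modzDm. Qed.

Fact padic_mul_subproof (x y : padic_int) k :
  (x k * y k = x k.+1 * y k.+1 %[mod M k])%Z.
Proof. by rewrite -modzMm !padic_coh modzMm. Qed.

Definition padic_cst n := padic_reduce (padic_cst_subproof n).
Definition padic_opp x := padic_reduce (padic_opp_subproof x).
Definition padic_add x y := padic_reduce (padic_add_subproof x y).
Definition padic_mul x y := padic_reduce (padic_mul_subproof x y).

Fact padic_addA : associative padic_add.
Proof.
by move=> x y z; apply: padic_ext => k /=; rewrite !modz_mod modzDmr modzDml addrA.
Qed.

Fact padic_addC : commutative padic_add.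
Proof. by move=> x y; apply: padic_ext => k /=; rewrite addrC. Qed.

Fact padic_add0 : left_id (padic_cst 0) padic_add.
Proof. by move=> x; apply: padic_ext => k /=; rewrite modz_mod modzDml add0r. Qed.

Fact padic_addN : left_inverse (padic_cst 0) padic_opp padic_add.
Proof. by move=> x; apply: padic_ext => k /=; rewrite modz_mod modzDml addNr modz_mod. Qed.

HB.instance Definition _ :=
  GRing.isZmodule.Build padic_int padic_addA padic_addC padic_add0 padic_addN.

Fact padic_mulA : associative padic_mul.
Proof.
by move=> x y z; apply: padic_ext => k /=; rewrite !modz_mod modzMmr modzMml mulrA.
Qed.

Fact padic_mulC : commutative padic_mul.
Proof. by move=> x y; apply: padic_ext => k /=; rewrite mulrC. Qed.

Fact padic_mul1 : left_id (padic_cst 1) padic_mul.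
Proof. by move=> x; apply: padic_ext => k /=; rewrite modz_mod modzMml mul1r. Qed.

Fact padic_mulD : left_distributive padic_mul padic_add.
Proof.
move=> x y z; apply: padic_ext => k /=.
by rewrite !modz_mod modzMml modzDm mulrDl.
Qed.

Fact padic_1neq0 : padic_cst 1 != 0.
Proof.
apply/eqP => /(congr1 (fun x : padic_int => x 1)) /=.
by rewrite /padic_modulus expr1.
Qed.

HB.instance Definition _ := GRing.Zmodule_isComNzRing.Build padic_int
  padic_mulA padic_mulC padic_mul1 padic_mulD padic_1neq0.

End PadicInt.

Definition has_padic_root (p : nat) (f : {poly int}) : Prop :=
  exists z : padic_int p, root (map_poly intr f) z.

Definition linear_quadratic (R : {poly int}) (a b : int) (Q : {poly int}) :
    Prop :=
  [/\ size R = 4%N, primitive_polyZ (linear_polyZ a b),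
      [/\ primitive_polyZ Q, irreducible_polyZ Q & size Q = 3%N]
    & eq_upto_sign R (linear_polyZ a b * Q)].

Definition resultant_val (p : nat) (Q : {poly int}) : nat :=
  logn p `|resultant Q Q^`()|%N.

(* Main.v *)
Require Import Defs.
From mathcomp Require Import all_boot all_order all_fingroup all_algebra.
From mathcomp Require Import boolp reals exp Rstruct.
From mathcomp Require Import ring lra zify.
Import Order.TTheory GRing.Theory Num.Theory.
Local Open Scope ring_scope.

(** Up to its content and to multiplicities, P has the same factors as its
radical R: R divides a power of P, and P divides a constant multiple of a power
of R.  Hence P and R are intersective together (radical_intersective), and by
the Chinese remainder theorem being intersective is a question about each
prime power separately.  A primitive linear form a x + b is a unit modulo p if
p divides a, and has a root modulo every power of p otherwise.  So a product of
linear forms is intersective exactly when no prime divides all the leading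
coefficients, and for a product of a x + b and a quadratic Q the primes
dividing a must be taken care of by Q.  There Hensel's lemma applies: writing
the resultant of Q and Q' as u Q + v Q' bounds the valuation of Q'(x) at an
approximate root x, so that a root modulo p^(2s+1) lifts to the p-adic integers
(padic_root_iff).

What remains, and carries the weight of the proof, is that an irreducible
polynomial of degree 2 or 3 has no root modulo some prime.  This usually comes
from the density theorems of Frobenius and Chebotarev; the proof below only
counts lattice points.

Upper bound.  Let f be monic and irreducible of degree d, and let N_p be its
number of roots modulo p.  Take u and v among the n^d polynomials of degree
less than d with coefficients in [0, n).  The norm of u - v in Z[x]/(f) is a
nonzero integer of size O(n^d).  At a given root of f modulo p, at least a
proportion 1/p of the pairs (u, v) agree, by Cauchy and Schwarz, and p^j divides
the norm if u and v agree at j roots.  Summing the logarithms of the norms gives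
(sum_roots_mod_primes_le)
  sum over p <= n^d of N_p ln p (1/p - 1/n^d)  <=  ln (n^d) + O(1).
The estimates of Chebyshev and Mertens show that the same sum with all N_p
replaced by 1 is at least ln (n^d) - O(1).  So if f has a root modulo every
prime, then the primes p at which f splits completely have a bounded sum of
ln p / p (split_sum_bounded).  For a quadratic, having a root means splitting
completely, which contradicts Mertens at once.

Lower bound.  For a cubic of discriminant D, a root modulo p and a nonzero
square D modulo p force complete splitting.  It is thus enough that the primes
modulo which D is a square have an unbounded sum of ln p / p
(sum_residue_unbounded).  Such are all the primes that divide a value
F(x, y) = (x + t y)^2 - D y^2 at coprime x and y.  A prime power q divides
F(x, y) only if (x, y) lies in one of two lattices of index about q, and such a
lattice contains at most X^2/q + 1 primitive vectors with 0 < y < x <= X,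
because their slopes are separated by q/X^2.  Since F has a positive proportion
of the X^2 pairs at its disposal and values of size X^2 or so there, comparing
X^2 ln X with the sum of ln F over the pairs yields the claim. *)

Local Notation pZtoQ := (map_poly (intr : int -> rat)).

(** * Logarithms and sums over primes *)

Lemma PoszX (a k : nat) : (a ^ k)%N%:Z = a%:Z ^+ k.
Proof. by rewrite -natz natrX natz. Qed.

Section LogPrimes.
Variable R : realType.

Definition lnn (n : nat) : R := ln n%:R.

Lemma lnn_ge0 n : 0 <= lnn n.
Proof.
case: n => [|n]; first by rewrite /lnn ln0.
by apply: ln_ge0; rewrite ler1n.
Qed.

Lemma lnn1 : lnn 1 = 0. Proof. exact: ln1. Qed.

Lemma lnnM m n : (0 < m)%N -> (0 < n)%N -> lnn (m * n) = lnn m + lnn n.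
Proof. by move=> m0 n0; rewrite /lnn natrM lnM // posrE ltr0n. Qed.

Lemma lnnX m k : (0 < m)%N -> lnn (m ^ k) = k%:R * lnn m.
Proof. by move=> m0; rewrite /lnn natrX lnXn ?ltr0n // mulr_natl. Qed.

Lemma le_lnn m n : (0 < m)%N -> (m <= n)%N -> lnn m <= lnn n.
Proof.
move=> m0 mn; rewrite /lnn ler_ln ?posrE ?ltr0n ?ler_nat //.
exact: leq_trans mn.
Qed.

Lemma lnn_prod (I : Type) (r : seq I) (P : pred I) (F : I -> nat) :
  (forall i, P i -> 0 < F i)%N ->
  lnn (\prod_(i <- r | P i) F i) = \sum_(i <- r | P i) lnn (F i).
Proof.
move=> F0; elim: r => [|i r IH]; first by rewrite !big_nil lnn1.
rewrite !big_cons; case: ifP => // Pi; rewrite lnnM ?IH ?F0 //.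
by rewrite prodn_cond_gt0.
Qed.

(** Unique factorization, with the primes summed up to a bound that can be
    shared by many integers. *)
Lemma ln_factor m N : (0 < m <= N)%N ->
  lnn m = \sum_(0 <= p < N.+1 | prime p) (logn p m)%:R * lnn p.
Proof.
case/andP=> m0 mN; rewrite -{1}(partnT m0) (widen_partn _ mN) lnn_prod; last first.
  by case=> [|p] _; rewrite ?expn_gt0 // lognE.
rewrite [LHS]big_mkcond [RHS]big_mkcond; apply: eq_bigr => p _ /=.
case: ifP => pp; first by rewrite lnnX ?prime_gt0.
by rewrite lognE pp /= expn0 lnn1.
Qed.

Lemma ln_factor_ge m N : (0 < m)%N ->
  \sum_(0 <= p < N.+1 | prime p) (logn p m)%:R * lnn p <= lnn m.
Proof.
move=> m0; rewrite (@ln_factor m (maxn m N)) ?m0 ?leq_maxl //.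
rewrite [leRHS](@big_cat_nat _ _ _ N.+1) ?ltnS ?leq_maxr //= lerDl.
by apply: sumr_ge0 => p _; rewrite mulr_ge0 ?lnn_ge0.
Qed.

Lemma lnn_unbounded (y : R) : exists n, y <= lnn n.+1.
Proof.
have l2 : 0 < lnn 2 by apply: ln_gt0; rewrite ltr1n.
pose k := Num.bound (`|y| / lnn 2).
exists (2 ^ k).-1; rewrite prednK ?expn_gt0 // lnnX //.
rewrite -ler_pdivrMr // ltW //; apply: le_lt_trans (archi_boundP _).
  by rewrite ler_pM2r ?invr_gt0 // ler_norm.
by rewrite divr_ge0 // ltW.
Qed.

(** Chebyshev's function: the logarithm of the least common multiple of 1,
    ..., n. *)
Definition psi n : R :=
  \sum_(0 <= p < n.+1 | prime p) (trunc_log p n)%:R * lnn p.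

Lemma psi_widen n N : (n <= N)%N ->
  psi n = \sum_(0 <= p < N.+1 | prime p) (trunc_log p n)%:R * lnn p.
Proof.
move=> nN; rewrite [RHS](@big_cat_nat _ _ _ n.+1) //=.
rewrite [X in _ + X]big_nat_cond [X in _ + X]big1 ?addr0 //.
move=> p /andP[/andP[np _] pp].
have /eqP-> : trunc_log p n == 0%N by rewrite trunc_log_eq0; lia.
by rewrite mul0r.
Qed.

Lemma le_psi n N : (n <= N)%N -> psi n <= psi N.
Proof.
move=> nN; rewrite (psi_widen _ _ nN); apply: ler_sum => p pp.
rewrite ler_wpM2r ?lnn_ge0 // ler_nat; apply: leq_trunc_log.
exact: nN.
Qed.

Lemma binom_central_le n : ('C(2 * n, n) <= 2 ^ (2 * n))%N.
Proof.
have -> : (2 ^ (2 * n) = \sum_(i < (2 * n).+1) 'C(2 * n, i))%N.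
  by rewrite (Pascal 1 1); apply: eq_bigr => i _; rewrite !exp1n !muln1.
have ltn2 : (n < (2 * n).+1)%N by lia.
by rewrite (bigD1 (Ordinal ltn2)) //= leq_addr.
Qed.

(** If p^k lies in (n, 2n], then the term of index k in Legendre's formula
    shows that p divides the central binomial coefficient. *)
Lemma trunc_log_central p n : prime p -> (0 < n)%N ->
  (trunc_log p (2 * n) <= trunc_log p n + logn p 'C(2 * n, n))%N.
Proof.
move=> pp n0; have p1 := prime_gt1 pp; set k := trunc_log p (2 * n).
have n20 : (0 < 2 * n)%N by lia.
have := trunc_logP p1 n20; rewrite -/k => pk.
have [k0|k0] := posnP k; first by lia.
have [pkn|npk] := leqP (p ^ k) n.
  by apply: (leq_trans (trunc_log_max p1 pkn)); rewrite leq_addr.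
have k1 : (k.-1 <= trunc_log p n)%N.
  apply: trunc_log_max => //; move: pk; rewrite -{1}(prednK k0) expnS.
  by nia.
have fE := @bin_fact (2 * n) n ltac:(lia).
have e2 : (2 * n - n = n)%N by lia.
rewrite e2 in fE; move/(congr1 (logn p)): fE.
rewrite !lognM ?muln_gt0 ?fact_gt0 ?bin_gt0 //; last by lia.
rewrite !logn_fact //.
have -> : (\sum_(1 <= j < n.+1) n %/ p ^ j = \sum_(1 <= j < (2 * n).+1) n %/ p ^ j)%N.
  rewrite [RHS](@big_cat_nat _ _ _ n.+1) //=; last by lia.
  rewrite [X in (_ + X)%N]big_nat_cond [X in (_ + X)%N]big1 ?addn0 //.
  move=> j /andP[/andP[nj _] _]; apply: divn_small.
  exact: ltn_trans nj (ltn_expl j p1).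
have kr : (1 <= k < (2 * n).+1)%N.
  by rewrite k0 ltnS ltnW // (leq_trans _ pk) // ltn_expl.
rewrite -big_split.
rewrite !(bigD1_seq k) ?mem_index_iota ?iota_uniq //=.
set S1 := (\sum_(_ <- _ | _) (_ + _))%N; set S2 := (\sum_(_ <- _ | _) _)%N.
have : (S1 <= S2)%N.
  apply: leq_sum => j _; rewrite leq_divRL ?expn_gt0 ?(ltnW p1) //.
  by rewrite mulnDl mul2n -addnn leq_add // leq_trunc_div.
have -> : (n %/ p ^ k = 0)%N by rewrite divn_small.
have : (1 <= 2 * n %/ p ^ k)%N by rewrite leq_divRL ?expn_gt0 ?(ltnW p1) // mul1n.
by lia.
Qed.

Lemma psi_double n : (0 < n)%N -> psi (2 * n) <= psi n + (2 * n)%:R.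
Proof.
move=> n0; rewrite (@psi_widen n (2 * n)); last by lia.
apply: (@le_trans _ _ (\sum_(0 <= p < (2 * n).+1 | prime p)
   ((trunc_log p n)%:R * lnn p + (logn p 'C(2 * n, n))%:R * lnn p))).
  apply: ler_sum => p pp; rewrite -mulrDl -natrD.
  by rewrite ler_wpM2r ?lnn_ge0 // ler_nat trunc_log_central.
rewrite big_split /= lerD2l.
have b0 : (0 < 'C(2 * n, n))%N by rewrite bin_gt0; lia.
apply: (le_trans (ln_factor_ge _ _ b0)).
apply: (le_trans (le_lnn _ _ b0 (binom_central_le n))).
rewrite lnnX // ler_piMr //.
have := @le_ln1Dx R 1 ltac:(lra).
by rewrite /lnn (_ : 1 + 1 = 2%:R) //; ring.
Qed.

(** Chebyshev's bound, by repeated halving: psi (2n) - psi n is at most the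
    logarithm of the central binomial coefficient, itself at most 4^n. *)
Lemma psi_le_linear n : psi n <= 6%:R * n%:R.
Proof.
have [k] := ubnP n; elim: k n => // k IH n nk.
have [n1|n1] := leqP n 1.
  rewrite /psi big_nat_cond big1 ?mulr_ge0 //.
  move=> p /andP[/andP[_ pn] pp]; have := prime_gt1 pp; lia.
pose m := uphalf n.
have mE : (m + m = n \/ m + m = n.+1)%N by rewrite /m; lia.
have nm : (n <= 2 * m)%N by lia.
apply: (le_trans (le_psi _ _ nm)).
apply: (le_trans (psi_double m ltac:(lia))).
apply: (le_trans (lerD (IH m ltac:(lia)) (lexx _))).
rewrite -!natrM -natrD ler_nat; lia.
Qed.

Lemma theta_le_psi n : \sum_(0 <= p < n.+1 | prime p) lnn p <= psi n.
Proof.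
rewrite /psi big_nat_cond [leRHS]big_nat_cond.
apply: ler_sum => p /andP[/andP[_ pn] pp].
rewrite ler_peMl ?lnn_ge0 // ler1n trunc_log_gt0 (prime_gt1 pp) /=.
by have := prime_gt1 pp; lia.
Qed.

Lemma logn_fact_le p n : prime p -> (p.-1 * logn p n`! <= n)%N.
Proof.
move=> pp; rewrite logn_fact //; have p1 := prime_gt1 pp.
suff H K : (p.-1 * \sum_(1 <= k < K.+1) n %/ p ^ k + n %/ p ^ K <= n)%N.
  by apply: leq_trans (H n); rewrite leq_addr.
elim: K => [|K IH]; first by rewrite big_geq // muln0 expn0 divn1.
rewrite big_nat_recr //= mulnDr; apply: leq_trans IH.
rewrite -addnA leq_add2l expnSr divnMA.
have := leq_trunc_div (n %/ p ^ K) p; nia.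
Qed.

Lemma lnnS_sub_le n : (0 < n)%N -> lnn n.+1 - lnn n <= n%:R^-1.
Proof.
move=> n0; have n0' : (0 : R) < n%:R by rewrite ltr0n.
have -> : lnn n.+1 - lnn n = ln (1 + n%:R^-1).
  rewrite /lnn -ln_div ?posrE ?ltr0n // -natr1 mulrDl divff ?gt_eqF //.
  by rewrite mul1r.
by apply: le_ln1Dx; rewrite (lt_trans (ltrN10 _)) // invr_gt0.
Qed.

Lemma lnn_fact n : n%:R * lnn n - n%:R <= lnn n`!.
Proof.
elim: n => [|n IH]; first by rewrite fact0 lnn1 mul0r subrr.
rewrite factS lnnM ?fact_gt0 //.
have [n0|n0] := posnP n; first by rewrite n0 fact0 lnn1; lra.
suff : n%:R * (lnn n.+1 - lnn n) <= 1 by rewrite -(natr1 n); lra.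
have n0' : (0 : R) < n%:R by rewrite ltr0n.
by rewrite -ler_pdivlMl // mulr1 lnnS_sub_le.
Qed.

(** The summand is at most the decrease of (ln m + 2) / m from m - 1 to m. *)
Lemma sum_ln_telescope N :
  \sum_(2 <= m < N.+2) lnn m / (m%:R * m.-1%:R) <= 2 - (lnn N.+1 + 2) / N.+1%:R.
Proof.
elim: N => [|N IH]; first by rewrite big_geq // lnn1; lra.
rewrite big_nat_recr //=.
apply: (le_trans (lerD IH (lexx _))).
have a0 : (0 : R) < N.+1%:R by rewrite ltr0n.
have -> : N.+2%:R = N.+1%:R + 1 :> R by rewrite natr1.
set a : R := N.+1%:R in a0 *.
have L : (a + 1) * (lnn N.+2 - lnn N.+1) <= 2.
  have a1 : 1 <= a by rewrite ler1n.
  apply: (le_trans (ler_wpM2l _ (lnnS_sub_le N.+1 isT))); first by lra.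
  rewrite -/a.
  have ai : a^-1 <= 1 by rewrite invf_le1.
  by rewrite mulrDl mulfV ?gt_eqF // mul1r -[leRHS](natrD R 1 1) lerD2l.
rewrite -subr_ge0.
have -> : 2 - (lnn N.+2 + 2) / (a + 1) -
  (2 - (lnn N.+1 + 2) / a + lnn N.+2 / ((a + 1) * a)) =
  (2 - (a + 1) * (lnn N.+2 - lnn N.+1)) / ((a + 1) * a).
  have an0 : a != 0 by rewrite gt_eqF.
  have a1n0 : a + 1 != 0 by rewrite gt_eqF //; lra.
  by clearbody a; field; rewrite an0 a1n0.
by apply: divr_ge0; [lra | apply: mulr_ge0; lra].
Qed.

(** Factor n!, whose logarithm is at least n ln n - n: the prime p
    contributes at most n ln p / (p - 1), and replacing p - 1 by p costs a
    convergent series. *)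
Lemma mertens_lower_bound n : (0 < n)%N ->
  lnn n - 3%:R <= \sum_(0 <= p < n.+1 | prime p) lnn p / p%:R.
Proof.
move=> n0; have n0' : (0 : R) < n%:R by rewrite ltr0n.
have f0 := fact_gt0 n.
have H : lnn n`! <= \sum_(0 <= p < n.+1 | prime p)
     (n%:R * (lnn p / p%:R) + n%:R * (lnn p / (p%:R * p.-1%:R))).
  have fN : (0 < n`! <= maxn n`! n)%N by rewrite f0 leq_maxl.
  rewrite (ln_factor _ _ fN) [leLHS](@big_cat_nat _ _ _ n.+1) //=; last first.
    by rewrite ltnS leq_maxr.
  rewrite [X in _ + X]big_nat_cond [X in _ + X]big1 ?addr0; last first.
    move=> p /andP[/andP[np _] pp]; rewrite logn_fact // big_nat_cond big1 ?mul0r //.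
    move=> k /andP[/andP[k0 _] _]; apply: divn_small; apply: (leq_trans np).
    by rewrite -[leqLHS]expn1 leq_exp2l ?prime_gt1.
  apply: ler_sum => p pp; have := logn_fact_le p n pp => h.
  have p1 := prime_gt1 pp.
  have p10 : (0 : R) < p.-1%:R by rewrite ltr0n; lia.
  have pE : p%:R = p.-1%:R + 1 :> R by rewrite natr1 prednK // prime_gt0.
  have -> : n%:R * (lnn p / p%:R) + n%:R * (lnn p / (p%:R * p.-1%:R)) =
     (n%:R / p.-1%:R) * lnn p.
    have an0 : (p.-1%:R : R) != 0 by rewrite gt_eqF.
    have a1n0 : (p.-1%:R : R) + 1 != 0 by rewrite gt_eqF //; lra.
    by rewrite pE; field; rewrite ?an0 ?a1n0.
  by rewrite ler_wpM2r ?lnn_ge0 // ler_pdivlMr // -natrM ler_nat mulnC.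
rewrite big_split /= -!mulr_sumr in H.
have T : \sum_(0 <= p < n.+1 | prime p) lnn p / (p%:R * p.-1%:R) <= 2%:R.
  apply: (@le_trans _ _ (\sum_(2 <= m < n.+2) lnn m / (m%:R * m.-1%:R))).
    rewrite [leRHS]big_nat_recr //=.
    have t0 m : 0 <= lnn m / (m%:R * m.-1%:R).
      by rewrite divr_ge0 ?lnn_ge0 // mulr_ge0.
    rewrite -[leLHS]addr0 lerD ?t0 //.
    rewrite [leLHS](@big_cat_nat _ _ _ 2) //=.
    rewrite [X in X + _]big_nat_cond [X in X + _]big1 ?add0r; last first.
      by move=> p /andP[/andP[_ p2] /prime_gt1]; lia.
    by rewrite [leLHS]big_mkcond; apply: ler_sum => m _; case: ifP.
  apply: (le_trans (sum_ln_telescope n)); rewrite gerBl divr_ge0 //.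
  by have := lnn_ge0 n.+1; lra.
have h := lnn_fact n.
rewrite -(ler_pM2l n0'); nra.
Qed.

End LogPrimes.

(** * Norms of residues modulo a monic polynomial *)

(** The matrix, in the basis of powers of x, of multiplication by b in
    Z[x]/(f); its determinant is the norm of b. *)
Definition mulmod_mx (f : {poly int}) d (b : {poly int}) : 'M[int]_d :=
  \matrix_(i < d, j < d) (Pdiv.CommonRing.rmodp ('X^i * b) f)`_j.

Section Norm.
Variables (f : {poly int}) (d : nat).
Hypotheses (f_monic : f \is monic) (f_size : size f = d.+1).

Lemma size_rmodp_f (q : {poly int}) : (size (Pdiv.CommonRing.rmodp q f) <= d)%N.
Proof. by rewrite -ltnS -f_size Pdiv.CommonRing.ltn_rmodp monic_neq0. Qed.

(** A vector in the kernel is a nonzero polynomial g of degree less than d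
    such that f divides g b, which an irreducible f cannot do. *)
Lemma det_mulmod_neq0 (b : {poly int}) :
  irreducible_poly f ->
  b != 0 -> (size b <= d)%N -> \det (mulmod_mx f d b) != 0.
Proof.
move=> f_irr b0 bd; apply/negP => /det0P[v v0 vM].
pose g : {poly int} := \sum_(i < d) v 0 i *: 'X^i.
have gE (i : 'I_d) : g`_i = v 0 i.
  rewrite coef_sum (bigD1 i) //= coefZ coefXn eqxx mulr1 big1 ?addr0 // => j ji.
  by rewrite coefZ coefXn eq_sym (inj_eq val_inj) (negbTE ji) mulr0.
have g0 : g != 0.
  apply: contraNneq v0 => g0; apply/eqP/rowP => i.
  by rewrite -gE g0 coef0 mxE.
have gd : (size g <= d)%N.
  apply: (leq_trans (size_sum _ _ _)); apply/bigmax_leqP => i _.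
  by rewrite (leq_trans (size_scale_leq _ _)) // size_polyXn.
have r0 : Pdiv.CommonRing.rmodp (g * b) f = 0.
  apply/polyP => j; rewrite coef0.
  have [jd|dj] := ltnP j d; last first.
    by rewrite nth_default // (leq_trans (size_rmodp_f _)).
  have /rowP/(_ (Ordinal jd)) := vM; rewrite !mxE => e; rewrite -[RHS]e /=.
  rewrite /g mulr_suml Pdiv.RingMonic.rmodp_sum // coef_sum.
  apply: eq_bigr => i _; rewrite mxE -scalerAl Pdiv.RingMonic.rmodpZ //.
  by rewrite coefZ.
have f_dvd : f %| g * b.
  by rewrite (Pdiv.RingMonic.rdivp_eq f_monic (g * b)) r0 addr0 dvdp_mull.
have cop (q : {poly int}) : q != 0 -> (size q <= d)%N -> coprimep f q.
  move=> q0 qd; rewrite irreducible_poly_coprime //; apply/negP => /(dvdp_leq q0).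
  by rewrite f_size ltnNge qd.
move: f_dvd; rewrite (Gauss_dvdpr _ (cop _ g0 gd)) => /(dvdp_leq b0).
by rewrite f_size ltnNge bd.
Qed.

Lemma det_mulmod_bound : exists2 C : nat, (0 < C)%N &
  forall (b : {poly int}) (n : nat), (size b <= d)%N ->
    (forall k, (`|(b`_k)%R| <= n)%N) ->
  (`|\det (mulmod_mx f d b)|%N <= C * n ^ d)%N.
Proof.
(* The entries of the matrix are at most K n, K bounding the coefficients of
   all the reductions of x^(i + k) modulo f. *)
pose K := \sum_(i < d) \sum_(k < d) \sum_(j < d) `|(Pdiv.CommonRing.rmodp ('X^(i + k)) f)`_j|.
have K0 : 0 <= K by do 3! [apply: sumr_ge0 => ? _].
exists (d`! * `|K| ^ d).+1%N => // b n bd bn.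
suff : `|\det (mulmod_mx f d b)| <= (d`! * `|K|%N ^ d * n ^ d)%N%:Z.
  by rewrite -abszE lez_nat mulSn => h; apply: (leq_trans h); rewrite leq_addl.
have ent i j : `|mulmod_mx f d b i j| <= K * n%:Z.
  rewrite mxE.
  have {1}-> : b = \sum_(k < d) b`_k *: 'X^k.
    rewrite -[LHS]coefK poly_def (big_ord_widen d (fun k => b`_k *: 'X^k)) //.
    rewrite [in LHS]big_mkcond /=; apply: eq_bigr => k _; case: ifP => // /negbT.
    by rewrite -leqNgt => h; rewrite nth_default // scale0r.
  rewrite mulr_sumr Pdiv.RingMonic.rmodp_sum // coef_sum.
  apply: (le_trans (ler_norm_sum _ _ _)).
  apply: (@le_trans _ _ (\sum_(k < d) `|(Pdiv.CommonRing.rmodp ('X^(i + k)) f)`_j| * n%:Z)).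
    apply: ler_sum => k _; rewrite -scalerAr Pdiv.RingMonic.rmodpZ // coefZ -exprD.
    by rewrite normrM mulrC ler_wpM2l // -abszE lez_nat.
  rewrite -mulr_suml ler_wpM2r //.
  rewrite /K [leRHS](bigD1 i) //= -[leLHS]addr0 lerD //; last first.
    by apply: sumr_ge0 => ? _; do 2! [apply: sumr_ge0 => ? _].
  apply: ler_sum => k _; rewrite (bigD1 j) //= lerDl.
  by apply: sumr_ge0.
rewrite /determinant; apply: (le_trans (ler_norm_sum _ _ _)).
apply: (@le_trans _ _ (\sum_(s : 'S_d) (K * n%:Z) ^+ d)).
  apply: ler_sum => s _; rewrite normrM normrX normrN1 expr1n mul1r normr_prod.
  rewrite -[in leRHS](card_ord d) -prodr_const; apply: ler_prod => i _.
  by rewrite normr_ge0 ent.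
rewrite sumr_const card_Sn exprMn -mulr_natl natz !PoszM !PoszX.
by rewrite (abszE K) (ger0_norm K0) mulrA.
Qed.

Lemma dvdz_det_cols (p : int) (A : 'M[int]_d) (J : pred 'I_d) :
  (forall i j, J j -> (p %| A i j)%Z) -> (p ^+ #|J| %| \det A)%Z.
Proof.
move=> pA.
pose w : 'rV[int]_d := \row_j (if J j then p else 1).
have -> : A = (\matrix_(i, j) (A i j %/ w ord0 j)%Z) *m diag_mx w.
  apply/matrixP => i j; rewrite mul_mx_diag !mxE.
  by case: ifP => [/pA/divzK //|_]; rewrite divz1 mulr1.
rewrite det_mulmx det_diag.
have -> : \prod_i w 0 i = p ^+ #|J|.
  rewrite -prodr_const [RHS]big_mkcond /=; apply: eq_bigr => j _; rewrite mxE.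
  by [].
exact: dvdz_mull.
Qed.

(** Each root r of f modulo p gives an eigenvector (1, r, ..., r^(d-1))
    modulo p with eigenvalue b(r). Multiplying by the Vandermonde matrix of
    d distinct residues, whose determinant is prime to p, makes a column
    divisible by p for each common root of f and b. Completing the roots by
    residues that need not be roots keeps the matrix square. *)
Lemma dvdz_det_mulmod (p : nat) (b : {poly int}) (s : 'I_d -> int) :
  prime p -> (forall i j, i != j -> ~~ (p %| s i - s j)%Z) ->
  (p%:Z ^+ #|[pred c | (p %| f.[s c])%Z && (p %| b.[s c])%Z]|
     %| \det (mulmod_mx f d b))%Z.
Proof.
move=> pp s_inj; set J := [pred c | _].
pose V := Vandermonde d (\row_c s c).
have copV : coprimez p (\det V).
  have cM x y : coprimez p x -> coprimez p y -> coprimez p (x * y).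
    by rewrite coprimezMr => -> ->.
  have c1 : coprimez p 1 by rewrite coprimezE coprimen1.
  rewrite det_Vandermonde; apply: (big_ind (fun x => coprimez p x : Prop)) => // i _.
  apply: (big_ind (fun x => coprimez p x : Prop)) => // j ij; rewrite !mxE coprimezE prime_coprime //.
  by rewrite -dvdzE; apply: s_inj; rewrite gt_eqF.
rewrite -(@Gauss_dvdzl _ _ (\det V)); last first.
  by rewrite coprimezXl.
rewrite -det_mulmx; apply: dvdz_det_cols => i c /andP[pf pb].
have -> : (mulmod_mx f d b *m V) i c = (Pdiv.CommonRing.rmodp ('X^i * b) f).[s c].
  rewrite mxE (horner_coef_wide _ (size_rmodp_f _)).
  by apply: eq_bigr => j _; rewrite !mxE.
have := Pdiv.RingMonic.rdivp_eq f_monic ('X^i * b).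
move=> /(congr1 (fun q => q.[s c])); rewrite !hornerE => E.
have -> : (Pdiv.CommonRing.rmodp ('X^i * b) f).[s c] = s c ^+ i * b.[s c] - (Pdiv.CommonRing.rdivp ('X^i * b) f).[s c] * f.[s c].
  by rewrite E addrAC subrr add0r.
by rewrite rpredB // dvdz_mull.
Qed.

End Norm.

(** The bound is the Cauchy-Schwarz inequality for the sizes of the p fibres
    of h. Counting coincident pairs, rather than points of one fibre, is
    what gives the sharp constant 1. *)
Lemma cauchy_schwarz_classes (T : finType) (p : nat) (h : T -> 'I_p) :
  (#|T| ^ 2 <= p * \sum_(u : T) \sum_(v : T) (h u == h v))%N.
Proof.
pose m (c : 'I_p) : nat := #|[pred u | h u == c]|.
have mT : (\sum_c m c = #|T|)%N.
  rewrite -sum1_card (partition_big h predT) //=; apply: eq_bigr => c _.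
  by rewrite sum1_card.
have -> : (\sum_(u : T) \sum_(v : T) (h u == h v) = \sum_c m c ^ 2)%N.
  rewrite (partition_big h predT) //=; apply: eq_bigr => c _.
  rewrite (eq_bigr (fun=> m c)); last first.
    move=> u /eqP hu; rewrite /m -sum1_card [RHS]big_mkcond /=.
    by apply: eq_bigr => v _; rewrite inE hu eq_sym; case: eqP.
  by rewrite sum_nat_const -mulnn.
have [->|/card_gt0P[u0 _]] := posnP #|T|; first by [].
have p0 : (0 < p)%N := leq_ltn_trans (leq0n _) (ltn_ord (h u0)).
have : 0 <= \sum_c (p%:Z * (m c)%:Z - #|T|%:Z) ^+ 2.
  by apply: sumr_ge0 => c _; rewrite sqr_ge0.
have -> : \sum_c (p%:Z * (m c)%:Z - #|T|%:Z) ^+ 2 =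
   p%:Z * (p%:Z * (\sum_c (m c ^ 2))%N%:Z - (#|T| ^ 2)%N%:Z).
  have -> : ((\sum_c m c ^ 2)%N%:Z = \sum_c ((m c)%:Z ^+ 2)).
    by rewrite -natz natr_sum; apply: eq_bigr => c _; rewrite natrX natz.
  have TE : #|T|%:Z = \sum_c (m c)%:Z.
    by rewrite -mT -natz natr_sum; apply: eq_bigr => c _; rewrite natz.
  have TX : (#|T| ^ 2)%N%:Z = #|T|%:Z * \sum_c (m c)%:Z.
    by rewrite -TE -expr2 -!natz natrX.
  rewrite (eq_bigr (fun c => p%:Z ^+ 2 * (m c)%:Z ^+ 2 -
     (2 * p%:Z * #|T|%:Z) * (m c)%:Z + #|T|%:Z ^+ 2)); last first.
    by move=> c _; ring.
  rewrite big_split /= sumrB -!mulr_sumr sumr_const card_ord TX -TE.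
  by rewrite -mulr_natl natz; ring.
have p0' : 0 < p%:Z by [].
rewrite (pmulr_rge0 _ p0') subr_ge0; lia.
Qed.

Section BoxPolynomials.
Variables (d n : nat).
Local Notation U := {ffun 'I_d -> 'I_n}.

(** The polynomial with coefficient vector u; out of range, insub and oapp
    supply the coefficient 0. *)
Definition box_poly (u : U) : {poly int} := \poly_(i < d) oapp (fun j => (u j : nat)%:Z) 0 (insub i).

Lemma box_polyE (u : U) (i : 'I_d) : (box_poly u)`_i = (u i : nat)%:Z.
Proof. by rewrite coef_poly ltn_ord valK. Qed.

Lemma size_box_polyB (u v : U) : (size (box_poly u - box_poly v)%R <= d)%N.
Proof.
apply: (leq_trans (size_polyD _ _)); rewrite size_polyN.
by rewrite geq_max !size_poly.
Qed.

Lemma coef_box_polyB (u v : U) k : (`|((box_poly u - box_poly v)%R`_k)%R| <= n)%N.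
Proof.
have [dk|kd] := leqP d k.
  by rewrite nth_default // (leq_trans (size_box_polyB u v)).
have -> : k = Ordinal kd by [].
rewrite coefB !box_polyE.
by have := ltn_ord (u (Ordinal kd)); have := ltn_ord (v (Ordinal kd)); lia.
Qed.

Lemma box_polyB_neq0 (u v : U) : u != v -> box_poly u - box_poly v != 0.
Proof.
apply: contraNneq => e; apply/eqP/ffunP => i; apply: val_inj.
apply: (can_inj absz_nat); rewrite -!box_polyE; apply/eqP.
by rewrite -subr_eq0 -coefB e coef0.
Qed.

(** Cauchy-Schwarz for the residue modulo p of the value at r; the term n^d
    counts the diagonal pairs. *)
Lemma card_box_pairs p (r : int) : (0 < p)%N ->
  (n ^ d * n ^ d <= p * (n ^ d + \sum_(u : U) \sum_(v : U | u != v)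
      ((p %| (box_poly u - box_poly v).[r])%Z : nat)))%N.
Proof.
move=> p0.
have hP (u : U) : (`|((box_poly u).[r] %% p)%Z| < p)%N.
  by have := @ltz_pmod (box_poly u).[r] p p0; have := modz_ge0 (box_poly u).[r] (lt0r_neq0 (p0 : 0 < p%:Z)); lia.
pose h u := Ordinal (hP u).
have cU : #|{: U}| = (n ^ d)%N by rewrite card_ffun !card_ord.
have := cauchy_schwarz_classes _ p h; rewrite cU -mulnn => H.
apply: (leq_trans H); rewrite leq_mul2l; apply/orP; right.
rewrite -cU -sum1_card -big_split /=; apply: leq_sum => u _.
rewrite (bigD1 u) //= eqxx leq_add2l.
rewrite (eq_bigl (fun v => u != v)); last by move=> v; rewrite eq_sym.
apply: leq_sum => v _.
have [/(congr1 val) /= e|//] := eqVneq (h u) (h v).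
suff -> : (p %| (box_poly u - box_poly v).[r])%Z by [].
rewrite hornerD hornerN -eqz_mod_dvd; apply/eqP.
by rewrite -[LHS]gez0_abs ?e ?gez0_abs // modz_ge0 // lt0r_neq0.
Qed.

End BoxPolynomials.

Section PrimeIdeals.
Variable R : realType.
Local Notation lnn := (@lnn R).

(** The upper half of Mertens' theorem for the field defined by f. Both
    sides bound the sum of ln |norm (u - v)| over the pairs of distinct u
    and v in the box of side n. The residues s p are arbitrary but distinct,
    and those that are roots of f are counted; g selects the primes for
    which such residues are available. *)
Lemma sum_roots_mod_primes_le (f : {poly int}) d :
  f \is monic -> size f = d.+1 ->
  irreducible_poly f ->
  exists C : R, forall (n : nat) (g : pred nat) (s : nat -> 'I_d -> int),
    (0 < n)%N ->
    (forall p, prime p -> g p ->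
       forall i j, i != j -> ~~ (p %| s p i - s p j)%Z) ->
  \sum_(0 <= p < (n ^ d).+1 | prime p && g p)
     #|[pred i | (p %| f.[s p i])%Z]|%:R * lnn p * (p%:R^-1 - (n ^ d)%:R^-1)
  <= lnn (n ^ d) + C.
Proof.
move=> f_monic f_size f_irr.
have [C C0 CP] := det_mulmod_bound _ d f_monic.
exists (lnn C) => n g s n0 s_inj.
pose U : finType := {ffun 'I_d -> 'I_n}.
pose N (u v : U) := `|\det (mulmod_mx f d (box_poly _ _ u - box_poly _ _ v))|%N.
set B := (n ^ d)%N; have B0 : (0 < B)%N by rewrite expn_gt0 n0.
have cU : #|{: U}| = B by rewrite card_ffun !card_ord.
pose w p := #|[pred i | (p %| f.[s p i])%Z]|.
pose J p (u v : U) := #|[pred c | (p %| f.[s p c])%Z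
          && (p %| (box_poly _ _ u - box_poly _ _ v).[s p c])%Z]|.
have N0 (u v : U) : u != v -> (0 < N u v)%N.
  move=> uv; rewrite absz_gt0; apply: (det_mulmod_neq0 _ _ f_monic f_size _ f_irr).
    exact: box_polyB_neq0.
  exact: size_box_polyB.
have NJ p (u v : U) : prime p -> g p -> u != v -> (J p u v <= logn p (N u v))%N.
  move=> pp gp uv; rewrite -pfactor_dvdn ?N0 //.
  have := dvdz_det_mulmod _ _ f_monic f_size p (box_poly _ _ u - box_poly _ _ v) (s p) pp (s_inj p pp gp).
  by rewrite dvdzE abszX.
have upper : \sum_(u : U) \sum_(v : U | u != v) lnn (N u v) <=
    B%:R ^+ 2 * (lnn C + lnn B).
  apply: (@le_trans _ _ (\sum_(u : U) \sum_(v : U) (lnn C + lnn B))).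
    apply: ler_sum => u _; rewrite big_mkcond; apply: ler_sum => v _.
    case: ifP => [uv|_]; last by rewrite addr_ge0 ?lnn_ge0.
    rewrite -lnnM //; apply: le_lnn; first exact: N0.
    by apply: CP; [exact: size_box_polyB | exact: coef_box_polyB].
  by rewrite !sumr_const cU -[leLHS]mulr_natl -[X in _ * X <= _]mulr_natl mulrA expr2.
have lower : \sum_(0 <= p < B.+1 | prime p && g p)
    lnn p * (\sum_(u : U) \sum_(v : U | u != v) (J p u v)%:R) <=
    \sum_(u : U) \sum_(v : U | u != v) lnn (N u v).
  under eq_bigr do rewrite mulr_sumr.
  rewrite exchange_big /=; apply: ler_sum => u _.
  under eq_bigr do rewrite mulr_sumr.
  rewrite exchange_big /=; apply: ler_sum => v uv.
  apply: (le_trans _ (ln_factor_ge R _ B (N0 u v uv))).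
  rewrite big_mkcondr; apply: ler_sum => p pp.
  case: ifP => [gp|_]; last by rewrite mulr_ge0 ?lnn_ge0.
  by rewrite mulrC ler_wpM2r ?lnn_ge0 // ler_nat NJ.
have pairs p : prime p -> g p ->
    (w p)%:R * B%:R ^+ 2 * (p%:R^-1 - B%:R^-1) <=
    \sum_(u : U) \sum_(v : U | u != v) (J p u v)%:R :> R.
  move=> pp gp.
  pose cnt c : nat := (\sum_(u : U) \sum_(v : U | u != v)
      ((p %| (box_poly _ _ u - box_poly _ _ v).[s p c])%Z : nat))%N.
  have -> : \sum_(u : U) \sum_(v : U | u != v) (J p u v)%:R =
     \sum_(c | (p %| f.[s p c])%Z) (cnt c)%:R :> R.
    rewrite -natr_sum exchange_big /= natr_sum; apply: eq_bigr => u _.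
    rewrite exchange_big /= natr_sum; apply: eq_bigr => v _.
    rewrite /J -sum1_card [in LHS]big_mkcond [in RHS]big_mkcond /=; congr _%:R.
    by apply: eq_bigr => c _; rewrite inE; case: (_ %| f.[_])%Z => //=; case: ifP.
  have -> : (w p)%:R * B%:R ^+ 2 * (p%:R^-1 - B%:R^-1) =
     \sum_(c | (p %| f.[s p c])%Z) B%:R ^+ 2 * (p%:R^-1 - B%:R^-1) :> R.
    by rewrite sumr_const -[RHS]mulr_natl mulrA.
  apply: ler_sum => c _.
  have p0 : (0 : R) < p%:R by rewrite ltr0n prime_gt0.
  have B0' : (0 : R) < B%:R by rewrite ltr0n.
  have := card_box_pairs d n p (s p c) (prime_gt0 pp); rewrite -/B -/(cnt c).
  rewrite -(ler_nat R) !natrM natrD -expr2 mulrC -ler_pdivrMr // => H.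
  have BB : B%:R ^+ 2 * B%:R^-1 = B%:R :> R by rewrite expr2 mulfK ?gt_eqF.
  by rewrite mulrBr BB lerBlDl.
have B2 : (0 : R) < B%:R ^+ 2 by rewrite exprn_gt0 // ltr0n.
rewrite -(ler_pM2l B2) [lnn B + _]addrC.
apply: le_trans upper; apply: le_trans lower.
rewrite mulr_sumr; apply: ler_sum => p /andP[pp gp].
have := ler_wpM2l (lnn_ge0 R p) (pairs p pp gp).
by apply: le_trans; rewrite /w le_eqVlt; apply/orP; left; apply/eqP; ring.
Qed.

End PrimeIdeals.

(** * Primes dividing values of a quadratic form *)

Definition ncoprime X : nat := (\sum_(1 <= x < X.+1) \sum_(1 <= y < x) coprime x y)%N.

(** This is the number of pairs 0 < y < x <= X of multiples of g, computed
    as twice a triangular number. *)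
Lemma sum_multiples g X : (0 < g)%N ->
  (2 * \sum_(1 <= x < X.+1) (g %| x) * (x.-1 %/ g) = X %/ g * (X %/ g).-1)%N.
Proof.
move=> g0; elim: X => [|X IH]; first by rewrite big_geq // div0n.
rewrite big_nat_recr //= mulnDr IH divnS //.
set h := (X %/ g)%N; clearbody h.
by case: (g %| X.+1)%N; case: h {IH} => [|h] /=; rewrite ?mul0n ?mul1n ?muln0 ?addn0 ?add0n; nia.
Qed.

(** A pair that is not coprime is counted at g = gcd (x, y) by the last sum. *)
Lemma ncoprime_ge X :
  (X * X.-1 <= 2 * ncoprime X + \sum_(2 <= g < X.+1) X %/ g * (X %/ g).-1)%N.
Proof.
have -> : (X * X.-1 = 2 * \sum_(1 <= x < X.+1) \sum_(1 <= y < x) 1)%N.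
  have := sum_multiples 1 X isT; rewrite divn1 => <-; congr (2 * _)%N.
  rewrite big_nat_cond [RHS]big_nat_cond; apply: eq_bigr => x /andP[/andP[x1 _] _].
  by rewrite dvd1n divn1 mul1n sum_nat_const_nat muln1 subn1.
(* The common divisor g is summed outside, so that sum_multiples applies. *)
apply: (@leq_trans (2 * (ncoprime X + \sum_(2 <= g < X.+1)
   \sum_(1 <= x < X.+1) (g %| x) * (x.-1 %/ g)))%N); last first.
  rewrite mulnDr leq_add2l big_distrr /= big_nat_cond [leqRHS]big_nat_cond.
  apply: leq_sum => g /andP[/andP[g2 _] _].
  by rewrite sum_multiples // ltnW.
rewrite leq_mul2l /= /ncoprime exchange_big /= -big_split /=.
rewrite big_nat_cond [leqRHS]big_nat_cond; apply: leq_sum => x.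
case/andP=> /andP[x1 xX] _.
apply: (@leq_trans (\sum_(1 <= y < x) (coprime x y + \sum_(2 <= g < X.+1) (g %| x) * (g %| y)))%N).
  rewrite big_nat_cond [leqRHS]big_nat_cond; apply: leq_sum => y.
  case/andP=> /andP[y1 yx] _; case: (boolP (coprime x y)) => [//|].
  rewrite /coprime => ng.
  have g0 : (0 < gcdn x y)%N by rewrite gcdn_gt0 x1.
  have gx : (gcdn x y <= x)%N by rewrite dvdn_leq ?dvdn_gcdl.
  rewrite (bigD1_seq (gcdn x y)) ?iota_uniq ?mem_index_iota //=; last first.
    by move/eqP: ng; lia.
  by rewrite dvdn_gcdl dvdn_gcdr.
rewrite big_split /= leq_add2l exchange_big /=.
apply: leq_sum => g _; rewrite -big_distrr /= leq_mul2l; apply/orP; right.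
by rewrite divn_count_dvd prednK.
Qed.

(** If the slopes y/x and y'/x' lie in the same interval of length 1/K, then
    the determinant is less than X^2/K, hence less than q, and being a
    multiple of q it cannot be positive. *)
Lemma slope_cell_le X q K x y x' y' : (X ^ 2 < K * q)%N ->
  (0 < x <= X)%N -> (0 < x' <= X)%N ->
  (q %| x%:Z * y'%:Z - x'%:Z * y%:Z)%Z ->
  (y * K %/ x = y' * K %/ x')%N -> (y * x' <= y' * x)%N.
Proof.
move=> KX /andP[x0 xX] /andP[x0' xX'] dq k; rewrite leqNgt; apply/negP => lt.
have u := ltn_ceil (y * K) x0.
have l := leq_trunc_div (y' * K) x'; rewrite -k in l.
set c := (y * K %/ x)%N in u l.
have dd : (q %| y * x' - y' * x)%N.
  move: dq.
  have -> : x%:Z * y'%:Z - x'%:Z * y%:Z = - (y * x' - y' * x)%N%:Z by lia.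
  by rewrite dvdzE abszN.
have qd : (q <= y * x' - y' * x)%N by apply: dvdn_leq => //; lia.
set dt := (y * x' - y' * x)%N in qd.
have dtE : (dt + y' * x = y * x')%N by rewrite /dt; lia.
have h1 : (dt * K + y' * K * x < c.+1 * x * x')%N.
  have -> : (dt * K + y' * K * x = y * K * x')%N.
    by rewrite mulnAC -mulnDl dtE mulnAC.
  by rewrite ltn_pmul2r.
have h2 : (c * x' * x <= y' * K * x)%N by rewrite leq_mul2r l orbT.
have h3 : (dt * K < x * x')%N.
  move: h1 h2; rewrite -!mulnA (mulnC x') mulSn; lia.
have h4 : (x * x' <= X ^ 2)%N by rewrite -mulnn leq_mul.
have h5 : (K * q <= dt * K)%N by rewrite mulnC leq_mul2r qd orbT.
lia.
Qed.

(** By slope_cell_le, two of the vectors whose slopes lie in the same of K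
    cells of [0, 1) are proportional, hence equal, being primitive. *)
Lemma card_primitive_le X q (B : {set 'I_X.+1 * 'I_X.+1}) : (0 < q)%N ->
  (forall a, a \in B -> (0 < a.2 < a.1)%N && coprime a.1 a.2) ->
  (forall a b, a \in B -> b \in B ->
     (q %| (a.1 : nat)%:Z * (b.2 : nat)%:Z - (b.1 : nat)%:Z * (a.2 : nat)%:Z)%Z) ->
  (#|B| <= (X ^ 2 %/ q).+1)%N.
Proof.
move=> q0 Bp Bq; set K := (X ^ 2 %/ q).+1.
have KX : (X ^ 2 < K * q)%N by rewrite /K ltn_ceil.
pose h (a : 'I_X.+1 * 'I_X.+1) : 'I_K := inord (a.2 * K %/ a.1).
have B1 a : a \in B -> (0 < a.1 <= X)%N.
  by case/Bp/andP=> /andP[_ aa] _; rewrite (leq_ltn_trans _ aa) //= -ltnS.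
have hE a : a \in B -> (h a = a.2 * K %/ a.1 :> nat)%N.
  move=> aB; have /andP[a0 _] := B1 a aB; move/Bp: aB => /andP[/andP[_ aa] _].
  by rewrite inordK // ltn_divLR // -/K mulnC ltn_pmul2l.
suff h_inj : {in B &, injective h}.
  by rewrite -(card_in_imset h_inj) -[leqRHS]card_ord max_card.
move=> a b aB bB /(congr1 val); rewrite /= !hE // => e.
have E : (a.2 * b.1 = b.2 * a.1)%N.
  apply/eqP; rewrite eqn_leq (slope_cell_le _ _ _ _ _ _ _ KX (B1 a aB) (B1 b bB) (Bq a b aB bB) e).
  by rewrite (slope_cell_le _ _ _ _ _ _ _ KX (B1 b bB) (B1 a aB) (Bq b a bB aB)).
have /andP[/andP[a0 aa] ca] := Bp a aB.
have /andP[/andP[b0 bb] cb] := Bp b bB.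
have d1 : (a.2 %| b.2)%N.
  by rewrite -(@Gauss_dvdl _ _ a.1) 1?coprime_sym // -E dvdn_mulr.
have d2 : (b.2 %| a.2)%N.
  by rewrite -(@Gauss_dvdl _ _ b.1) 1?coprime_sym // E dvdn_mulr.
have e2 : a.2 = b.2 :> nat by apply/eqP; rewrite eqn_dvd d1.
have e1 : a.1 = b.1 :> nat.
  by move: E; rewrite e2 => /eqP; rewrite eqn_pmul2l // => /eqP.
by case: a b e1 e2 {aB bB e E a0 aa ca b0 bb cb d1 d2} => [? ?] [? ?] /= /val_inj-> /val_inj->.
Qed.

(** The exponents of p in m and in n add up to at least k and are both less
    than k - e, so both exceed e. *)
Lemma prime_power_split p k e (m n : int) : prime p -> (e <= k)%N ->
  (p%:Z ^+ k %| m * n)%Z -> ~~ (p%:Z ^+ (k - e) %| m)%Z ->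
  ~~ (p%:Z ^+ (k - e) %| n)%Z ->
  (p%:Z ^+ e.+1 %| m)%Z && (p%:Z ^+ e.+1 %| n)%Z.
Proof.
move=> pp ek; rewrite !dvdzE !abszX abszM /=.
set M := `|m|%N; set N := `|n|%N.
have [->|M0] := posnP M; first by rewrite dvdn0.
have [->|N0] := posnP N; first by rewrite !dvdn0.
by rewrite !pfactor_dvdn ?muln_gt0 ?M0 // lognM //; lia.
Qed.

Section QuadraticForm.
Variable D : int.
Hypothesis D0 : D != 0.

Let t : int := `|D| + 1.

(** The form x^2 + 2 t x y + (t^2 - D) y^2 of discriminant 4 D, with t so
    large that all its coefficients are positive: its values are at least
    x^2, whatever the sign of D. *)
Definition quad_val (x y : nat) : nat := `|((x%:Z + t * y%:Z) ^+ 2 - D * y%:Z ^+ 2)%R|%N.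

Lemma quad_valE x y : (quad_val x y)%:Z = (x%:Z + t * y%:Z) ^+ 2 - D * y%:Z ^+ 2.
Proof.
rewrite /quad_val gez0_abs // subr_ge0 /t.
have x0 : 0 <= x%:Z by []. have y0 : 0 <= y%:Z by [].
have : D <= `|D| by rewrite ler_norm. have : 0 <= `|D| by [].
nia.
Qed.

Lemma quad_val_ge x y : (x ^ 2 <= quad_val x y)%N.
Proof.
rewrite -lez_nat quad_valE -mulnn PoszM /t.
have x0 : 0 <= x%:Z by []. have y0 : 0 <= y%:Z by [].
have : D <= `|D| by rewrite ler_norm. have : 0 <= `|D| by [].
nia.
Qed.

Lemma quad_val_le X x y : (x <= X)%N -> (y <= X)%N ->
  (quad_val x y <= ((`|D| + 2) ^ 2 + `|D|) * X ^ 2)%N.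
Proof.
move=> xX yX; apply: (@leq_trans ((x + (`|D| + 1) * y) ^ 2 + `|D| * y ^ 2)%N).
  rewrite /quad_val /t; have := ler_norm D; rewrite -lez_nat; nia.
rewrite [leqRHS]mulnDl; apply: leq_add; last by rewrite leq_mul2l leq_sqr yX orbT.
by rewrite -expnMn leq_sqr; nia.
Qed.

Definition form_multiples X q : {set 'I_X.+1 * 'I_X.+1} :=
  [set a : 'I_X.+1 * 'I_X.+1 | [&& (0 < a.2 < a.1)%N, coprime a.1 a.2 & (q %| quad_val a.1 a.2)%N]].

Lemma form_multiples_dvd (m : nat) x y : (m %| quad_val x y)%N ->
  (m%:Z %| (x%:Z + t * y%:Z) ^+ 2 - D * y%:Z ^+ 2)%Z.
Proof. by rewrite -quad_valE dvdzE. Qed.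

Lemma form_prime_ndvd p x y : prime p -> coprime x y -> (p %| quad_val x y)%N ->
  ~~ (p %| y)%N.
Proof.
move=> pp cxy /form_multiples_dvd dF; apply/negP => py.
have py' : (p%:Z %| y%:Z)%Z by rewrite dvdzE.
have pu : (p%:Z %| x%:Z + t * y%:Z)%Z.
  have : (p%:Z %| (x%:Z + t * y%:Z) ^+ 2)%Z.
    rewrite -(rpredBr _ (_ : D * y%:Z ^+ 2 \in dvdz p)) //.
    by rewrite dvdz_mull // dvdz_exp.
  by rewrite !dvdzE abszX Euclid_dvdX // => /andP[].
have px : (p %| x)%N.
  have : (p%:Z %| x%:Z)%Z.
    by rewrite -(rpredDr _ (_ : t * y%:Z \in dvdz p)) // dvdz_mull.
  by rewrite dvdzE.
have : (p %| gcdn x y)%N by rewrite dvdn_gcd px.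
by rewrite (eqP cxy) Euclid_dvd1.
Qed.

(** With u = x + t y, both u / y and u0 / y0 are square roots of D modulo
    p^k, so p^k divides a difference of two squares. The two factors can
    share only a power of p dividing 4 D, and up to that power p^k divides
    one of them: there are at most two classes of solutions, and the bound
    holds for the primes dividing 2 D as well. *)
Lemma form_dichotomy p k x y x0 y0 : prime p -> (0 < k)%N ->
  coprime x y -> (p ^ k %| quad_val x y)%N ->
  coprime x0 y0 -> (p ^ k %| quad_val x0 y0)%N ->
  let q := p%:Z ^+ (k - logn p `|(4 * D)%R|%N) in
  let u := x%:Z + t * y%:Z in let u0 := x0%:Z + t * y0%:Z in
  (q %| u * y0%:Z - u0 * y%:Z)%Z || (q %| u * y0%:Z + u0 * y%:Z)%Z.
Proof.
move=> pp k0 c d c0 d0 /=; set e := logn p _.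
set u := x%:Z + t * y%:Z; set u0 := x0%:Z + t * y0%:Z.
have pk m : (p ^ k %| m)%N -> (p %| m)%N by apply: dvdn_trans; rewrite dvdn_exp.
have py := form_prime_ndvd p x y pp c (pk _ d).
have py0 := form_prime_ndvd p x0 y0 pp c0 (pk _ d0).
have dF := form_multiples_dvd _ _ _ d; have dF0 := form_multiples_dvd _ _ _ d0.
rewrite -/u -/u0 PoszX in dF dF0.
have [ke|ek] := leqP k e.
  by move: ke; rewrite -subn_eq0 => /eqP->; rewrite expr0 dvd1z.
rewrite -[_ || _]negbK negb_or; apply/negP => /andP[n1 n2].
have : (p%:Z ^+ k %| (u * y0%:Z - u0 * y%:Z) * (u * y0%:Z + u0 * y%:Z))%Z.
  have -> : (u * y0%:Z - u0 * y%:Z) * (u * y0%:Z + u0 * y%:Z) =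
    y0%:Z ^+ 2 * (u ^+ 2 - D * y%:Z ^+ 2) - y%:Z ^+ 2 * (u0 ^+ 2 - D * y0%:Z ^+ 2).
    by ring.
  by rewrite rpredB ?dvdz_mull.
move=> H; have /andP[d1 d2] := prime_power_split p k e _ _ pp (ltnW ek) H n1 n2.
have du : (p%:Z ^+ e.+1 %| 2 * u)%Z.
  have : (p%:Z ^+ e.+1 %| (2 * u) * y0%:Z)%Z.
    have -> : (2 * u) * y0%:Z = (u * y0%:Z - u0 * y%:Z) + (u * y0%:Z + u0 * y%:Z) by ring.
    by rewrite rpredD.
  rewrite Gauss_dvdzl // coprimezXl // coprimezE prime_coprime //.
have d4 : (p%:Z ^+ e.+1 %| 4 * D)%Z.
  have : (p%:Z ^+ e.+1 %| (4 * D) * y%:Z ^+ 2)%Z.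
    have -> : (4 * D) * y%:Z ^+ 2 = (2 * u) * (2 * u) - 4 * (u ^+ 2 - D * y%:Z ^+ 2) by ring.
    have dF' : (p%:Z ^+ e.+1 %| u ^+ 2 - D * y%:Z ^+ 2)%Z.
      exact: dvdz_trans (dvdz_exp2l _ ek) dF.
    exact: rpredB (dvdz_mull _ du) (dvdz_mull _ dF').
  by rewrite Gauss_dvdzl // coprimezXl // coprimezXr // coprimezE prime_coprime.
move: d4; rewrite dvdzE abszX pfactor_dvdn ?ltnn //.
by rewrite absz_gt0 mulf_neq0.
Qed.

(** Each of the two classes of solutions modulo p^k lies in a lattice of
    index p^(k - e), whose primitive vectors are few by the argument on
    slopes. *)
Lemma card_form_multiples p k X : prime p -> (0 < k)%N ->
  (#|form_multiples X (p ^ k)| <= 2 * (X ^ 2 %/ p ^ (k - logn p `|(4 * D)%R|)).+1)%N.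
Proof.
move=> pp k0; set e := logn p _; set A := form_multiples _ _.
have [->|[a0 a0A]] := set_0Vmem A; first by rewrite cards0.
set q := (p ^ (k - e))%N.
have q0 : (0 < q)%N by rewrite expn_gt0 prime_gt0.
have AP a : a \in A -> [/\ (0 < a.2 < a.1)%N, coprime a.1 a.2 & (p ^ k %| quad_val a.1 a.2)%N].
  by rewrite inE => /and3P.
have [_ c0 d0] := AP _ a0A.
pose u (a : 'I_X.+1 * 'I_X.+1) : int := (a.1 : nat)%:Z + t * (a.2 : nat)%:Z.
pose y (a : 'I_X.+1 * 'I_X.+1) : int := (a.2 : nat)%:Z.
pose B (s : int) := [set a in A | (q%:Z %| u a * y a0 + s * u a0 * y a)%Z].
have cB s : (#|B s| <= (X ^ 2 %/ q).+1)%N.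
  apply: card_primitive_le => // [a|a b].
    by rewrite inE => /andP[/AP[-> ->]].
  rewrite !inE => /andP[_ da] /andP[_ db].
  have cq : coprimez q (y a0).
    rewrite coprimezE /q coprimeXl // prime_coprime // /y.
    apply: (form_prime_ndvd p _ _ pp c0).
    by apply: dvdn_trans d0; rewrite dvdn_exp.
  rewrite -(Gauss_dvdzl _ cq).
  have -> : ((a.1 : nat)%:Z * (b.2 : nat)%:Z - (b.1 : nat)%:Z * (a.2 : nat)%:Z) * y a0 =
    y b * (u a * y a0 + s * u a0 * y a) - y a * (u b * y a0 + s * u a0 * y b).
    by rewrite /u /y; ring.
  by rewrite rpredB ?dvdz_mull.
have sub : A \subset B (-1) :|: B 1.
  apply/subsetP => a aA; have [_ c d] := AP _ aA.
  have := form_dichotomy p k _ _ _ _ pp k0 c d c0 d0.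
  rewrite in_setU [X in _ -> X || _]in_set [X in _ -> _ || X]in_set aA /=.
  by rewrite -/e -PoszX -/q !mulN1r !mul1r !mulNr.
apply: (leq_trans (subset_leq_card sub)); apply: (leq_trans (leq_card_setU _ _)).
by rewrite mul2n -addnn leq_add.
Qed.

Definition primitive_pairs X : {set 'I_X.+1 * 'I_X.+1} :=
  [set a : 'I_X.+1 * 'I_X.+1 | (0 < a.2 < a.1)%N && coprime a.1 a.2].

Lemma card_primitive_pairs X : #|primitive_pairs X| = ncoprime X.
Proof.
transitivity (\sum_(x < X.+1) \sum_(y < X.+1) ((0 < y < x) && coprime x y : nat))%N.
  rewrite pair_bigA -sum1_card big_mkcond /=; apply: eq_bigr => a _.
  by rewrite inE; case: ifP.
pose G x := (\sum_(0 <= y < X.+1) ((0 < y < x) && coprime x y : nat))%N.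
transitivity (\sum_(0 <= x < X.+1) G x)%N.
  by rewrite big_mkord; apply: eq_bigr => x _; rewrite /G big_mkord.
rewrite big_ltn // {1}/G big1 ?add0n; last by move=> y _; rewrite ltn0 andbF.
rewrite /ncoprime big_nat_cond [RHS]big_nat_cond; apply: eq_bigr => x /andP[/andP[x1 xX] _].
rewrite /G (@big_cat_nat _ _ _ x) //=; last by rewrite ltnW.
rewrite [X in (_ + X)%N]big_nat_cond [X in (_ + X)%N]big1 ?addn0; last first.
  by move=> y /andP[/andP[xy _] _]; rewrite (ltnNge y) xy andbF.
rewrite big_ltn //= add0n big_nat_cond [RHS]big_nat_cond.
by apply: eq_bigr => y /andP[/andP[-> ->] _].
Qed.

(** The square root of D modulo p is (x + t y) / y, the denominator being
    invertible by coprimality. *)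
Lemma form_multiples_residue p k X (a : 'I_X.+1 * 'I_X.+1) : prime p -> (0 < k)%N ->
  a \in form_multiples X (p ^ k) -> exists z : int, (p %| z ^+ 2 - D)%Z.
Proof.
move=> pp k0; rewrite inE => /and3P[_ c d].
have {}d : (p %| quad_val a.1 a.2)%N by apply: dvdn_trans d; rewrite dvdn_exp.
have py := form_prime_ndvd p _ _ pp c d.
have dF := form_multiples_dvd _ _ _ d.
set y : int := (a.2 : nat)%:Z in dF; set u : int := (a.1 : nat)%:Z + t * y in dF.
have /coprimezP[[v w] /= e] : coprimez p y by rewrite coprimezE prime_coprime.
exists (u * w).
have -> : (u * w) ^+ 2 - D = w ^+ 2 * (u ^+ 2 - D * y ^+ 2) + (D * (w * y + 1) * (- v)) * p%:Z.
  have -> : D * (w * y + 1) * (- v) * p%:Z = - (D * (w * y + 1)) * (v * p%:Z) by ring.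
  have -> : v * p%:Z = 1 - w * y by rewrite -e; ring.
  by ring.
by apply: rpredD; [exact: dvdz_mull dF | exact: dvdz_mull (dvdzz p)].
Qed.

Variable R : realType.
Local Notation lnn := (@lnn R).

Lemma sum_inv_powers (p : nat) L : (1 < p)%N ->
  \sum_(1 <= k < L.+1) ((p ^ k)%:R^-1 : R) <= 2 / p%:R.
Proof.
move=> p1.
have p2 : (2 : R) <= p%:R by rewrite ler_nat.
have p0 : (0 : R) < p%:R by lra.
suff : \sum_(1 <= k < L.+1) ((p ^ k)%:R^-1 : R) <= 2 / p%:R - 2 / (p ^ L.+1)%:R.
  by move=> h; apply: (le_trans h); rewrite gerBl divr_ge0.
elim: L => [|L IH]; first by rewrite big_geq // expn1 subrr.
rewrite big_nat_recr //=; apply: (le_trans (lerD IH (lexx _))).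
rewrite (expnS _ L.+1) natrM invfM.
set r : R := (p ^ L.+1)%:R^-1 in IH *.
have r0 : 0 <= r by rewrite invr_ge0.
have pi : p%:R^-1 <= 2^-1 :> R by rewrite lef_pV2 // posrE.
have := ler_wpM2r r0 pi; lra.
Qed.

(** The sum of 1/g^2 over g >= 2 is at most 3/4, so the pairs with a common
    factor cannot fill the triangle. *)
Lemma ncoprime_lower X : X%:R ^+ 2 / 4 - X%:R <= 2 * (ncoprime X)%:R :> R.
Proof.
have H := ncoprime_ge X.
have S2 N : \sum_(2 <= g < N.+3) (g%:R ^- 2 : R) <= 3 / 4 - N.+2%:R^-1.
  elim: N => [|N IH]; first by rewrite big_nat1; lra.
  rewrite big_nat_recr //=; apply: (le_trans (lerD IH (lexx _))).
  have -> : N.+3%:R = N.+2%:R + 1 :> R by rewrite natr1.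
  have a0 : (0 : R) < N.+2%:R by rewrite ltr0n.
  set a : R := N.+2%:R in a0 *; clearbody a.
  have an0 : a != 0 by rewrite gt_eqF.
  have a1n0 : a + 1 != 0 by rewrite gt_eqF //; lra.
  rewrite -subr_ge0.
  have -> : 3 / 4 - (a + 1)^-1 - (3 / 4 - a^-1 + (a + 1) ^- 2) =
     (a * (a + 1) ^+ 2)^-1.
    by field; rewrite an0 a1n0.
  by rewrite invr_ge0 mulr_ge0 ?sqr_ge0 // ltW.
have S3 : \sum_(2 <= g < X.+1) (g%:R ^- 2 : R) <= 3 / 4.
  case: X {H} => [|[|N]]; try by rewrite big_geq //; lra.
  by apply: (le_trans (S2 N)); rewrite gerBl invr_ge0.
have S4 : (\sum_(2 <= g < X.+1) X %/ g * (X %/ g).-1)%N%:R <= X%:R ^+ 2 * (3 / 4) :> R.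
  apply: (@le_trans _ _ (X%:R ^+ 2 * \sum_(2 <= g < X.+1) (g%:R ^- 2 : R))); last first.
    by rewrite ler_wpM2l // sqr_ge0.
  rewrite mulr_sumr natr_sum big_nat_cond [leRHS]big_nat_cond.
  apply: ler_sum => g /andP[/andP[g2 _] _].
  have g0 : (0 : R) < g%:R by rewrite ltr0n; lia.
  have h : (X %/ g)%:R <= X%:R / g%:R :> R.
    by rewrite ler_pdivlMr // -natrM ler_nat leq_trunc_div.
  apply: (@le_trans _ _ ((X %/ g)%:R ^+ 2)).
    by rewrite -natrX ler_nat -mulnn leq_mul2l leq_pred orbT.
  rewrite -expr_div_n; apply: lerXn2r h; rewrite nnegrE ?ler0n //.
  by rewrite divr_ge0.
have S1 : X%:R ^+ 2 - X%:R <= (X * X.-1)%N%:R :> R.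
  case: (X) => [|N]; first by rewrite expr0n /= mul0n; lra.
  by rewrite natrM /= -(natr1 N); nra.
move: H; rewrite -(ler_nat R) natrD natrM; lra.
Qed.

(** The pairs with x < s are set aside because the form may take small
    values there. *)
Lemma card_short s X : (#|[set a : 'I_X.+1 * 'I_X.+1 | (a.1 < s)%N && (a.2 < a.1)%N]| <= s ^ 2)%N.
Proof.
pose I := [set i : 'I_X.+1 | (i < s)%N].
have cI : (#|I| <= s)%N.
  case: s @I => [|s] I.
    by rewrite leqn0 cards_eq0; apply/eqP/setP => i; rewrite !inE.
  have -> : I = [set inord i | i : 'I_s.+1 & (i < X.+1)%N].
    apply/setP => i; rewrite inE; apply/idP/imsetP => [lt|[j]].
      by exists (inord i); rewrite ?inE; [rewrite inordK | apply: val_inj; rewrite /= !inordK].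
    by rewrite inE => jX ->; rewrite inordK.
  by apply: (leq_trans (leq_imset_card _ _)); rewrite -[leqRHS]card_ord max_card.
apply: (@leq_trans #|setX I I|); last by rewrite cardsX -mulnn leq_mul.
apply/subset_leq_card/subsetP => -[x y]; rewrite !inE /= => /andP[xs yx].
by rewrite xs (ltn_trans yx).
Qed.

Lemma card_form_multiples_real p k X : prime p -> (0 < k)%N ->
  #|form_multiples X (p ^ k)|%:R <=
    2 * (`|(4 * D)%R|%N%:R * X%:R ^+ 2 * (p ^ k)%:R^-1 + 1) :> R.
Proof.
move=> pp k0; have p0 := prime_gt0 pp.
have H := card_form_multiples p k X pp k0.
move: H; set E := `|(4 * D)%R|%N; set e := logn p E; set q := (p ^ (k - e))%N => H.
have E0 : (0 < E)%N by rewrite absz_gt0 mulf_neq0.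
have qE : (p ^ k <= q * E)%N.
  apply: (@leq_trans (q * p ^ e)%N).
    by rewrite /q -expnD leq_exp2l ?prime_gt1 //; lia.
  by rewrite leq_mul2l dvdn_leq ?orbT // pfactor_dvdnn.
have h : (X ^ 2 %/ q * p ^ k <= E * X ^ 2)%N.
  apply: (@leq_trans (X ^ 2 %/ q * q * E)%N); first by rewrite -mulnA leq_mul2l qE orbT.
  by rewrite mulnC leq_mul2l leq_trunc_div orbT.
apply: (@le_trans _ _ (2 * (X ^ 2 %/ q).+1)%N%:R); first by rewrite ler_nat.
rewrite natrM ler_wpM2l // -natr1 lerD2r ler_pdivlMr ?ltr0n ?expn_gt0 ?p0 //.
by rewrite -natrX -!natrM ler_nat.
Qed.

(** The exponent of p in m as the number of powers of p dividing m,
    restricted to the powers up to the size of m. *)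
Lemma logn_le_count (p m L : nat) : prime p -> (0 < m)%N -> (m < p ^ L.+1)%N ->
  (logn p m <= \sum_(1 <= k < L.+1) (p ^ k %| m))%N.
Proof.
move=> pp m0 mL; set l := logn p m.
have lL : (l <= L)%N.
  rewrite -ltnS -(ltn_exp2l _ _ (prime_gt1 pp)); apply: leq_ltn_trans mL.
  by rewrite dvdn_leq // pfactor_dvdnn.
rewrite (@big_cat_nat _ _ _ l.+1) //= [X in (_ <= X + _)%N]big_nat_cond.
rewrite (eq_bigr (fun=> 1%N)).
  by rewrite -big_nat_cond sum_nat_const_nat muln1 subn1 leq_addr.
by move=> k /andP[/andP[_ kl] _]; rewrite pfactor_dvdn // -ltnS kl.
Qed.

Variable S : pred nat.
Hypothesis S_residue : forall p (z : int), prime p -> (p %| z ^+ 2 - D)%Z -> S p.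

Let c : nat := ((`|D| + 2) ^ 2 + `|D|)%N.
Let E : nat := `|(4 * D)%R|%N.

(** Factor every value of the form. The prime powers p^k contribute a
    geometric series bounded by 2/p, times X^2, and an error of at most 2
    for each prime power up to c X^2, which Chebyshev's bound absorbs. *)
Lemma sum_log_form_le X : (0 < X)%N ->
  \sum_(a in primitive_pairs X) lnn (quad_val a.1 a.2) <=
  X%:R ^+ 2 * (4 * E%:R * (\sum_(0 <= p < (c * X ^ 2).+1 | prime p && S p) lnn p / p%:R)
                + 12 * c%:R).
Proof.
move=> X0; set Z := (c * X ^ 2)%N.
have c0 : (0 < c)%N by rewrite /c addn_gt0 expn_gt0 addn2.
have Z0 : (0 < Z)%N by rewrite /Z muln_gt0 c0 expn_gt0 X0.
have F_bound (a : 'I_X.+1 * 'I_X.+1) : a \in primitive_pairs X ->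
    (0 < quad_val a.1 a.2 <= Z)%N.
  rewrite inE => /andP[/andP[y0 yx] _]; apply/andP; split.
    by apply: leq_trans (quad_val_ge _ _); rewrite expn_gt0 (leq_ltn_trans _ yx).
  by apply: quad_val_le; rewrite -ltnS ltn_ord.
have -> : \sum_(a in primitive_pairs X) lnn (quad_val a.1 a.2) =
   \sum_(0 <= p < Z.+1 | prime p) lnn p *
     \sum_(a in primitive_pairs X) (logn p (quad_val a.1 a.2))%:R.
  under [RHS]eq_bigr do rewrite mulr_sumr.
  rewrite [RHS]exchange_big /=; apply: eq_bigr => a aT.
  by rewrite (ln_factor R _ _ (F_bound a aT)); apply: eq_bigr => p _; rewrite mulrC.
have bound p : prime p -> \sum_(a in primitive_pairs X) (logn p (quad_val a.1 a.2))%:R <=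
    if S p then 4 * E%:R * X%:R ^+ 2 / p%:R + 2 * (trunc_log p Z)%:R else 0 :> R.
  move=> pp; have p1 := prime_gt1 pp.
  set L := trunc_log p Z.
  apply: (@le_trans _ _ (\sum_(1 <= k < L.+1) #|form_multiples X (p ^ k)|%:R)).
    rewrite -!natr_sum ler_nat.
    have -> : (\sum_(1 <= k < L.+1) #|form_multiples X (p ^ k)| =
      \sum_(a in primitive_pairs X) \sum_(1 <= k < L.+1) (p ^ k %| quad_val a.1 a.2))%N.
      rewrite exchange_big /=; apply: eq_bigr => k _.
      rewrite -sum1_card [LHS]big_mkcond [RHS]big_mkcond /=; apply: eq_bigr => a _.
      by rewrite !inE andbA; case: (_ && coprime _ _) => //=; case: (_ %| _)%N.
    apply: leq_sum => a aT; have /andP[F0 FZ] := F_bound a aT.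
    apply: logn_le_count => //; apply: (leq_ltn_trans FZ).
    exact: trunc_log_ltn.
  have [Sp|nSp] := boolP (S p); last first.
    rewrite big_nat_cond big1 // => k /andP[/andP[k1 _] _].
    case: (set_0Vmem (form_multiples X (p ^ k))) => [->|[a aA]]; first by rewrite cards0.
    have [z dz] := form_multiples_residue p k X a pp k1 aA.
    by move: nSp; rewrite (S_residue _ _ pp dz).
  apply: (@le_trans _ _ (\sum_(1 <= k < L.+1)
      (2 * E%:R * X%:R ^+ 2 * (p ^ k)%:R^-1 + 2))).
    rewrite big_nat_cond [leRHS]big_nat_cond; apply: ler_sum => k /andP[/andP[k1 _] _].
    by apply: (le_trans (card_form_multiples_real p k X pp k1)); rewrite mulrDr mulr1 !mulrA.
  rewrite big_split /= -mulr_sumr.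
  have -> : \sum_(1 <= k < L.+1) 2 = 2 * L%:R :> R.
    by rewrite sumr_const_nat subn1 /= mulr_natr.
  rewrite lerD2r.
  have h0 : 0 <= 2 * E%:R * X%:R ^+ 2 :> R by rewrite !mulr_ge0 ?sqr_ge0.
  apply: (le_trans (ler_wpM2l h0 (sum_inv_powers p L p1))).
  by rewrite le_eqVlt; apply/orP; left; apply/eqP; ring.
apply: (@le_trans _ _ (\sum_(0 <= p < Z.+1 | prime p && S p)
   (4 * E%:R * X%:R ^+ 2 * (lnn p / p%:R)) +
   2 * \sum_(0 <= p < Z.+1 | prime p) (trunc_log p Z)%:R * lnn p)).
  rewrite big_mkcondr mulr_sumr -big_split /=; apply: ler_sum => p pp.
  apply: (le_trans (ler_wpM2l (lnn_ge0 _ _) (bound p pp))).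
  have h : 0 <= (trunc_log p Z)%:R * lnn p by rewrite mulr_ge0 ?lnn_ge0.
  case: ifP => _; last by rewrite mulr0 add0r mulr_ge0.
  by rewrite le_eqVlt; apply/orP; left; apply/eqP; ring.
rewrite -mulr_sumr -/(psi R Z).
have := psi_le_linear R Z; rewrite {2}/Z natrM natrX.
set s := \sum_(_ <= _ < _ | _) _; nra.
Qed.

(** The left side of sum_log_form_le is at least X^2 ln X / 16, for X a
    large square: a positive proportion of the pairs is coprime, and all but
    X of them have x^2 >= X. *)
Lemma sum_residue_unbounded (M : R) : exists n : nat,
  M <= \sum_(0 <= p < n.+1 | prime p && S p) lnn p / p%:R.
Proof.
(* The size of ln X that makes X^2 ln X / 16 exceed the right side of
   sum_log_form_le with the sum over p replaced by M. *)
pose y : R := 64 * E%:R * M + 192 * c%:R.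
have [m m0 my] : exists2 m : nat, (24 <= m)%N & y <= lnn m.
  have [k yk] := lnn_unbounded R y.
  exists (maxn 24 k.+1); first exact: leq_maxl.
  by apply: (le_trans yk); apply: le_lnn; rewrite ?leq_maxr.
pose X := (m ^ 2)%N.
have X0 : (0 < X)%N by rewrite expn_gt0; lia.
have X24 : (24 : R) <= X%:R by rewrite ler_nat /X; nia.
exists (c * X ^ 2)%N.
set s := \sum_(_ <= _ < _ | _) _.
have up := sum_log_form_le X X0; rewrite -/s in up.
have lnX : y <= lnn X.
  by apply: (le_trans my); apply: le_lnn; [lia | rewrite /X; nia].
pose short := [set a : 'I_X.+1 * 'I_X.+1 | (a.1 < m)%N && (a.2 < a.1)%N].
have low : (#|primitive_pairs X|%:R - X%:R) * lnn X <=
    \sum_(a in primitive_pairs X) lnn (quad_val a.1 a.2).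
  apply: (@le_trans _ _ (\sum_(a in primitive_pairs X :\: short) lnn X)).
    rewrite sumr_const -[leRHS]mulr_natl ler_wpM2r ?lnn_ge0 // lerBlDr -natrD ler_nat.
    rewrite cardsD -[leqLHS](subnK (subset_leq_card (subsetIl _ short))) leq_add2l.
    exact: leq_trans (subset_leq_card (subsetIr _ _)) (card_short m X).
  rewrite [leRHS](bigID (fun a => a \in short)) /= addrC.
  rewrite -[leLHS]addr0; apply: lerD; last by apply: sumr_ge0 => a _; exact: lnn_ge0.
  rewrite (eq_bigl (fun a => (a \in primitive_pairs X) && (a \notin short))); last first.
    by move=> a; rewrite inE andbC.
  apply: ler_sum => a /andP[aT]; move: aT; rewrite !inE => /andP[/andP[y0 yx] _].
  rewrite yx andbT -leqNgt => ma; apply: le_lnn => //.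
  by apply: leq_trans (quad_val_ge _ _); rewrite leq_sqr.
have cnt := ncoprime_lower X; rewrite -card_primitive_pairs in cnt.
set T : R := #|_|%:R in low cnt.
have T16 : X%:R ^+ 2 / 16 <= T - X%:R by nra.
have X2 : (0 : R) < X%:R ^+ 2 by rewrite exprn_gt0 // ltr0n.
have fin : X%:R ^+ 2 / 16 * lnn X <= X%:R ^+ 2 * (4 * E%:R * s + 12 * c%:R).
  apply: le_trans up; apply: le_trans low.
  by rewrite ler_wpM2r ?lnn_ge0.
rewrite -mulrA (ler_pM2l X2) in fin.
have E0 : (0 : R) < E%:R by rewrite ltr0n absz_gt0 mulf_neq0.
rewrite -(ler_pM2l E0); rewrite /y in lnX; nra.
Qed.

End QuadraticForm.

(** * Completely split primes *)

Section SplitPrimes.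
Variable R : realType.
Local Notation lnn := (@lnn R).

Lemma lnn_div_ge0 p : 0 <= lnn p / p%:R.
Proof. by rewrite divr_ge0 ?lnn_ge0. Qed.

(** Apply the upper bound to residues that contain all the roots of f if p
    splits (p in S), and at least one root otherwise. Each prime then
    contributes at least once and a split prime at least twice; the single
    contributions already account for ln (n^d) by Mertens, which leaves O(1)
    for the extra ones. *)
Lemma split_sum_bounded (f : {poly int}) d (S : pred nat) :
  f \is monic -> size f = d.+1 -> (1 < d)%N ->
  irreducible_poly f ->
  (forall p, prime p -> exists z, (p %| f.[z])%Z) ->
  (forall p, prime p -> S p -> exists s : 'I_d -> int,
     (forall i j, i != j -> ~~ (p %| s i - s j)%Z) /\
     (forall i, (p %| f.[s i])%Z)) ->
  exists M : R, forall N : nat,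
    \sum_(0 <= p < N.+1 | prime p && S p) lnn p / p%:R <= M.
Proof.
move=> f_monic f_size d1 f_irr f_root S_split.
have [C CP] := sum_roots_mod_primes_le R f d f_monic f_size f_irr.
pose K : R := \sum_(0 <= p < d.+1 | prime p) lnn p / p%:R.
exists (C + K + 15) => N.
pose good p := S p || (d <= p)%N.
have [s sP] : {s : nat -> 'I_d -> int & forall p, prime p -> good p ->
    (forall i j, i != j -> ~~ (p %| s p i - s p j)%Z) /\
    (1 + S p <= #|[pred i | (p %| f.[s p i])%Z]|)%N}.
  apply: (@choice _ _ (fun p sp => prime p -> good p ->
    (forall i j, i != j -> ~~ (p %| sp i - sp j)%Z) /\
    (1 + S p <= #|[pred i | (p %| f.[sp i])%Z]|)%N)) => p.
  have [pp|npp] := boolP (prime p); last by exists (fun=> 0).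
  have [Sp|nSp] := boolP (S p).
    have [s [s_inj s_root]] := S_split p pp Sp; exists s => _ _; split=> //.
    suff -> : #|[pred i | (p %| f.[s i])%Z]| = d by [].
    by rewrite -[RHS](card_ord d); apply: eq_card => i; rewrite !inE s_root.
  (* The d residues z, z + 1, ... are distinct modulo p as soon as p >= d. *)
  have [z zr] := f_root p pp; exists (fun i : 'I_d => z + (i : nat)%:Z) => _.
  rewrite /good (negbTE nSp) /= => dp; split.
    move=> i j ij; rewrite opprD addrACA subrr add0r.
    have := ltn_ord i; have := ltn_ord j => jd id.
    apply/negP; rewrite dvdzE => /dvdn_leq; have := ij; rewrite -(inj_eq val_inj) /=.
    by lia.
  have d0 : (0 < d)%N by lia.
  by apply/card_gt0P; exists (Ordinal d0); rewrite inE addr0.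
have n0 : (0 < N.+1)%N by [].
have := CP N.+1 good s n0 (fun p pp gp => (sP p pp gp).1).
set B := (N.+1 ^ d)%N => H.
have NB : (N.+1 <= B)%N by rewrite -[leqLHS]expn1 leq_pexp2l // ltnW.
have B0 : (0 < B)%N by lia.
have B0' : (0 : R) < B%:R by rewrite ltr0n.
have t0 p : (prime p) -> (p <= B)%N -> 0 <= lnn p * (p%:R^-1 - B%:R^-1).
  move=> pp pB; rewrite mulr_ge0 ?lnn_ge0 // subr_ge0.
  by rewrite lef_pV2 ?posrE ?ltr0n ?ler_nat ?(prime_gt0 pp).
have H1 : \sum_(0 <= p < B.+1 | prime p) lnn p * (p%:R^-1 - B%:R^-1) - K +
    \sum_(0 <= p < B.+1 | prime p && S p) lnn p * (p%:R^-1 - B%:R^-1) <= lnn B + C.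
  apply: le_trans H; rewrite big_mkcondr [leRHS]big_mkcondr /=.
  rewrite addrAC -big_split /= lerBlDr.
  have -> : K = \sum_(0 <= p < (maxn B d).+1 | prime p) if (p <= d)%N then lnn p / p%:R else 0.
    rewrite [RHS](@big_cat_nat _ _ _ d.+1) //=; last by lia.
    rewrite [X in _ = _ + X]big_nat_cond [X in _ = _ + X]big1 ?addr0; last first.
      by move=> p /andP[/andP[dp _] _]; rewrite leqNgt dp.
    rewrite /K [LHS]big_nat_cond [RHS]big_nat_cond; apply: eq_bigr => p /andP[/andP[_ pd] _].
    by move: pd; rewrite ltnS => ->.
  rewrite -[leLHS]addr0 [X in _ <= _ + X](@big_cat_nat _ _ _ B.+1) //=; last by lia.
  rewrite addrA; apply: lerD; last first.
    by apply: sumr_ge0 => p _; case: ifP => // _; exact: lnn_div_ge0.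
  rewrite -big_split /= big_nat_cond [leRHS]big_nat_cond.
  apply: ler_sum => p /andP[/andP[_ pB] pp].
  rewrite -mulrA; set T := lnn p * (_ - _).
  have T0 : 0 <= T by exact: t0.
  have TK : T <= lnn p / p%:R by rewrite ler_wpM2l ?lnn_ge0 // gerBl invr_ge0.
  case: (boolP (good p)) => gp.
    have [_ cnt] := sP p pp gp; set W := #|_| in cnt *.
    apply: (@le_trans _ _ ((1 + S p)%N%:R * T)).
      by rewrite natrD mulrDl mul1r lerD2l; case: (S p); rewrite ?mul1r ?mul0r.
    rewrite -[leLHS]addr0; apply: lerD; first by rewrite ler_wpM2r // ler_nat.
    by case: ifP => // _; exact: lnn_div_ge0.
  move: gp; rewrite /good negb_or => /andP[/negbTE-> dp].
  by rewrite ifT ?addr0 ?add0r //; lia.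
have TE (P : pred nat) : \sum_(0 <= p < B.+1 | prime p && P p) lnn p * (p%:R^-1 - B%:R^-1) =
   \sum_(0 <= p < B.+1 | prime p && P p) lnn p / p%:R -
   (\sum_(0 <= p < B.+1 | prime p && P p) lnn p) / B%:R.
  rewrite mulr_suml -sumrB; apply: eq_bigr => p _; exact: mulrBr.
have theta (P : pred nat) : (\sum_(0 <= p < B.+1 | prime p && P p) lnn p) / B%:R <= 6.
  rewrite ler_pdivrMr //; apply: (le_trans _ (psi_le_linear R B)).
  apply: (le_trans _ (theta_le_psi R B)).
  rewrite big_mkcondr; apply: ler_sum => p _; case: ifP => // _; exact: lnn_ge0.
have TA := TE predT; have thA := theta predT.
rewrite !(eq_bigl _ _ (fun p => andbT (prime p))) in TA thA.
rewrite TA TE in H1.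
have thS := theta S.
have me := mertens_lower_bound R B B0.
have le : \sum_(0 <= p < N.+1 | prime p && S p) lnn p / p%:R <=
          \sum_(0 <= p < B.+1 | prime p && S p) lnn p / p%:R.
  rewrite [leRHS](@big_cat_nat _ _ _ N.+1) //=; last by lia.
  by rewrite lerDl sumr_ge0 // => p _; exact: lnn_div_ge0.
lra.
Qed.

End SplitPrimes.

(** * Irreducible quadratics and cubics have no root modulo some prime *)

Lemma dvdz_Fp p (x : int) : prime p -> (p %| x)%Z = (x%:~R == 0 :> 'F_p).
Proof. by move=> pp; rewrite (dvdz_pcharf (pchar_Fp pp)). Qed.

(** A root would be a linear factor. *)
Lemma irreducible_noroot (F : fieldType) (f : {poly F}) x :
  irreducible_poly f -> (2 < size f)%N -> f.[x] != 0.
Proof.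
move=> [_ f_irr] f2; apply/negP => fx.
have := f_irr ('X - x%:P); rewrite size_XsubC dvdp_XsubCl /root => /(_ isT fx).
by move/eqp_size; rewrite size_XsubC => e; rewrite -e in f2.
Qed.

Section NotIntersective.
Variable R : realType.
Local Notation lnn := (@lnn R).

(** Finitely many bad primes never matter: those dividing m contribute at
    most ln m. *)
Lemma sum_prime_divisors_le m N : (0 < m)%N ->
  \sum_(0 <= p < N.+1 | prime p && (p %| m)%N) lnn p / p%:R <= lnn m.
Proof.
move=> m0; apply: (le_trans _ (ln_factor_ge R m N m0)).
rewrite big_mkcondr; apply: ler_sum => p pp; case: ifP => [pm|_]; last first.
  by rewrite mulr_ge0 ?lnn_ge0.
rewrite mulrC ler_wpM2r ?lnn_ge0 //; apply: (@le_trans _ _ 1).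
  by rewrite invf_le1 ?ltr0n ?ler1n ?prime_gt0.
by rewrite ler1n logn_gt0 mem_primes pp m0.
Qed.

Lemma sum_prime_split (S : pred nat) m N : (0 < m)%N ->
  \sum_(0 <= p < N.+1 | prime p && S p) lnn p / p%:R <=
  \sum_(0 <= p < N.+1 | prime p && (S p && ~~ (p %| m)%N)) lnn p / p%:R + lnn m.
Proof.
move=> m0; rewrite (bigID (fun p => p %| m)%N) /= addrC; apply: lerD.
  by rewrite le_eqVlt; apply/orP; left; apply/eqP; apply: eq_bigl => p; rewrite andbA.
apply: (le_trans _ (sum_prime_divisors_le m N m0)).
rewrite [leLHS]big_mkcond [leRHS]big_mkcond; apply: ler_sum => p _.
by case: (prime p) => //=; case: (S p); case: (_ %| _)%N => //=; exact: lnn_div_ge0.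
Qed.

(** Completing the square replaces f by x^2 - D, where D is the
    discriminant, which is not a square. For p not dividing 2 D, a root w of
    x^2 - D comes with the distinct root - w. *)
Lemma quadratic_no_root_mod_some_prime (f : {poly int}) :
  irreducible_poly f -> size f = 3 ->
  ~ (forall p, prime p -> exists z, (p %| f.[z])%Z).
Proof.
move=> f_irr f_size H.
pose a := f`_2; pose b := f`_1; pose c := f`_0.
have fE z : f.[z] = a * z ^+ 2 + b * z + c.
  by rewrite horner_coef f_size !big_ord_recl big_ord0 /= /a /b /c /bump /=; ring.
have fQE z : (pZtoQ f).[z] = a%:~R * z ^+ 2 + b%:~R * z + c%:~R.
  rewrite horner_coef size_rat_int_poly f_size !big_ord_recl big_ord0 /= !coef_map.
  by rewrite /a /b /c /bump /=; ring.
have a0 : a != 0.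
  by have := lead_coef_eq0 f; rewrite lead_coefE f_size -/a => ->; rewrite -size_poly_eq0 f_size.
pose D := b ^+ 2 - 4 * a * c.
have D_nsq (y : rat) : y ^+ 2 != D%:~R.
  apply/negP => /eqP yD.
  have := @irreducible_noroot _ _ ((y - b%:~R) / (2 * a%:~R)) (proj2 (irreducible_rat_int f) f_irr).
  rewrite size_rat_int_poly f_size fQE => /(_ isT) /eqP; apply.
  have aQ : (a%:~R : rat) != 0 by rewrite intr_eq0.
  have -> : c%:~R = (b%:~R ^+ 2 - y ^+ 2) / (4 * a%:~R) :> rat.
    by rewrite yD /D; field.
  by field.
have D0 : D != 0.
  by apply: contraNneq (D_nsq 0) => ->; rewrite expr0n.
pose g : {poly int} := 'X^2 - D%:P.
have gE z : g.[z] = z ^+ 2 - D by rewrite /g !hornerE.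
have szD : (size (- D%:P : {poly int}) < size ('X^2 : {poly int}))%N.
  by rewrite size_polyN size_polyXn (leq_ltn_trans (size_polyC_leq1 _)).
have g_size : size g = 3 by rewrite /g (size_polyDl szD) size_polyXn.
have g_monic : g \is monic.
  by rewrite /g monicE (lead_coefDl szD) lead_coefXn.
have g_irr : irreducible_poly g.
  apply/irreducible_rat_int; apply: cubic_irreducible; first by rewrite size_rat_int_poly g_size.
  move=> y; rewrite /root rmorphB /= map_polyXn map_polyC /= !hornerE subr_eq0.
  exact: D_nsq.
pose S p := ~~ (p %| `|(2 * D)%R|)%N.
have mD0 : (0 < `|(2 * D)%R|)%N by rewrite absz_gt0 mulf_neq0.
have sq_root p : prime p -> exists w, (p %| w ^+ 2 - D)%Z.
  move=> pp; have [z zf] := H p pp; exists (2 * a * z + b).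
  have -> : (2 * a * z + b) ^+ 2 - D = 4 * a * f.[z] by rewrite fE /D; ring.
  exact: dvdz_mull.
have g_root p : prime p -> exists w, (p %| g.[w])%Z.
  by move=> pp; have [w ww] := sq_root p pp; exists w; rewrite gE.
have g_split p : prime p -> S p -> exists s : 'I_2 -> int,
    (forall i j, i != j -> ~~ (p %| s i - s j)%Z) /\ (forall i, (p %| g.[s i])%Z).
  move=> pp Sp; have [w ww] := sq_root p pp.
  exists (fun i => (-1) ^+ i * w); split=> [i j ij|i]; last first.
    by rewrite gE exprMn sqrr_sign mul1r.
  have nw : ~~ (p %| 2 * w)%Z.
    apply: contra Sp => d2w.
    suff : (p %| 2 * D)%Z by rewrite dvdzE.
    have -> : 2 * D = w * (2 * w) - 2 * (w ^+ 2 - D) by ring.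
    by apply: rpredB; [exact: dvdz_mull d2w | exact: dvdz_mull ww].
  case: i j ij => [[|[|//]] ?] [[|[|//]] ?] //= _; rewrite ?expr0 ?expr1.
    by rewrite mul1r mulN1r opprK -mulr2n -mulr_natl.
  by rewrite mul1r mulN1r -opprD rpredN -mulr2n -mulr_natl.
have [M MP] := split_sum_bounded R g 2 S g_monic g_size isT g_irr g_root g_split.
have [n nP] := lnn_unbounded R (M + lnn `|(2 * D)%R|%N + 4).
have := sum_prime_split predT _ n.+1 mD0.
rewrite (eq_bigl _ _ (fun p => andbT (prime p))) => h.
have me := mertens_lower_bound R n.+1 isT; have := MP n.+1; rewrite /S /=; lra.
Qed.

(** Dividing by x - r leaves the quadratic q(x) = x^2 + u x + v, whose
    discriminant times q(r)^2 is the discriminant z^2 of the cubic. So z /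
    q(r) is a square root of the discriminant of q. *)
Lemma cubic_split_field (F : fieldType) (b c e r z : F) : 2%:R != 0 :> F ->
  r ^+ 3 + b * r ^+ 2 + c * r + e = 0 ->
  z ^+ 2 = b ^+ 2 * c ^+ 2 - 4 * c ^+ 3 - 4 * b ^+ 3 * e - 27 * e ^+ 2 + 18 * b * c * e ->
  z != 0 ->
  exists2 s : 'I_3 -> F, injective s &
    forall i, s i ^+ 3 + b * s i ^+ 2 + c * s i + e = 0.
Proof.
move=> n2 re zD z0.
have eE : e = - (r ^+ 3 + b * r ^+ 2 + c * r).
  by apply/eqP; rewrite -addr_eq0 addrC re.
pose u := b + r; pose v := c + r * u; pose Q := 3 * r ^+ 2 + 2 * b * r + c.
have zQ : z ^+ 2 = (u ^+ 2 - 4 * v) * Q ^+ 2.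
  by rewrite zD eE /Q /v /u; ring.
have Q0 : Q != 0.
  by apply: contraNneq z0 => Q0; rewrite -sqrf_eq0 zQ Q0 expr0n mulr0.
pose w := z / Q.
have w0 : w != 0 by rewrite mulf_neq0 ?invr_eq0.
have ww : w ^+ 2 = u ^+ 2 - 4 * v.
  by rewrite /w exprMn zQ exprVn mulfK // expf_neq0.
pose q x := x ^+ 2 + u * x + v.
have fq x : x ^+ 3 + b * x ^+ 2 + c * x + e = (x - r) * q x.
  by rewrite eE /q /v /u; ring.
have qr : q r = Q by rewrite /q /Q /v /u; ring.
have n4 : 4%:R != 0 :> F by rewrite (natrM _ 2 2) mulf_neq0.
pose s1 := (- u + w) / 2%:R; pose s2 := (- u - w) / 2%:R.
have vE : v = (u ^+ 2 - w ^+ 2) / 4%:R by rewrite ww; field.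
have q1 : q s1 = 0 by rewrite /q vE /s1; field; rewrite ?n2 ?n4.
have q2 : q s2 = 0 by rewrite /q vE /s2; field; rewrite ?n2 ?n4.
have r1 : r != s1 by apply: contraNneq Q0 => e1; rewrite -qr e1 q1.
have r2 : r != s2 by apply: contraNneq Q0 => e1; rewrite -qr e1 q2.
have s12 : s1 != s2.
  apply: contraNneq w0 => e1.
  have -> : w = s1 - s2 by rewrite /s1 /s2; field.
  by rewrite e1 subrr.
exists (fun i : 'I_3 => nth r [:: r; s1; s2] i).
  move=> [[|[|[|//]]] ?] [[|[|[|//]]] ?] //= eq; apply/val_inj => //=.
  - by move: r1; rewrite eq eqxx.
  - by move: r2; rewrite eq eqxx.
  - by move: r1; rewrite eq eqxx.
  - by move: s12; rewrite eq eqxx.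
  - by move: r2; rewrite eq eqxx.
  - by move: s12; rewrite eq eqxx.
by move=> [[|[|[|//]]] ?] /=; rewrite fq ?subrr ?mul0r ?q1 ?q2 ?mulr0.
Qed.

Definition cubic_disc (A : comNzRingType) (b c e : A) : A :=
  b ^+ 2 * c ^+ 2 - 4 * c ^+ 3 - 4 * b ^+ 3 * e - 27 * e ^+ 2 + 18 * b * c * e.

Lemma cubic_split_mod p (b c e r z : int) : prime p -> ~~ (p %| 2)%N ->
  (p %| r ^+ 3 + b * r ^+ 2 + c * r + e)%Z ->
  (p %| z ^+ 2 - cubic_disc _ b c e)%Z -> ~~ (p %| cubic_disc _ b c e)%Z ->
  exists s : 'I_3 -> int, (forall i j, i != j -> ~~ (p %| s i - s j)%Z) /\
    (forall i, (p %| s i ^+ 3 + b * s i ^+ 2 + c * s i + e)%Z).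
Proof.
move=> pp p2 pr pz pD; pose F := 'F_p.
have dF x : (p %| x)%Z = (x%:~R == 0 :> F) by exact: dvdz_Fp.
have n2 : 2%:R != 0 :> F.
  by have := dF 2; rewrite dvdzE /= (negbTE p2) => /esym/negbT.
have [|||s s_inj s_root] := @cubic_split_field F b%:~R c%:~R e%:~R r%:~R z%:~R n2.
- by move: pr; rewrite dF => /eqP <-; ring.
- by move: pz; rewrite dF => /eqP z0; apply/eqP; rewrite -subr_eq0 -z0 /cubic_disc; apply/eqP; ring.
- apply: contraNneq pD => z0; rewrite dF; move: pz.
  by rewrite dF rmorphB rmorphXn /= z0 expr0n /= sub0r oppr_eq0.
have sE i : ((s i : nat)%:Z)%:~R = s i by rewrite -[RHS]natr_Zp.
exists (fun i => (s i : nat)%:Z); split=> [i j ij|i].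
  by rewrite dF rmorphB /= !sE subr_eq0 (inj_eq s_inj).
by rewrite dF !(rmorphD, rmorphXn, rmorphM) /= !sE s_root.
Qed.

(** A cubic of discriminant zero has a multiple root, which is a rational
    expression in the coefficients. *)
Lemma cubic_disc_eq0 (F : fieldType) (b c e : F) : 2%:R != 0 :> F -> 3%:R != 0 :> F ->
  cubic_disc _ b c e = 0 -> exists x, x ^+ 3 + b * x ^+ 2 + c * x + e = 0.
Proof.
move=> n2 n3 D0.
have [E|E] := eqVneq (b ^+ 2) (3 * c).
  exists (- b / 3%:R).
  have cE : c = b ^+ 2 / 3%:R by rewrite E; field.
  have : (27%:R * e - b ^+ 3) ^+ 2 = - 27%:R * cubic_disc _ b c e.
    by rewrite /cubic_disc cE; field.
  rewrite D0 mulr0 => /eqP; rewrite sqrf_eq0 subr_eq0 => /eqP h.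
  have n27 : 27%:R != 0 :> F by rewrite (natrX _ 3 3) expf_neq0.
  have -> : e = b ^+ 3 / 27%:R by rewrite -h; field.
  by rewrite cE; field; rewrite ?n3 ?n27.
have k0 : b ^+ 2 - 3 * c != 0 by rewrite subr_eq0.
(* The double root; when the root is triple, b^2 = 3 c. *)
exists ((9 * e - b * c) / (2 * (b ^+ 2 - 3 * c))).
have n8 : 8%:R != 0 :> F by rewrite (natrX _ 2 3) expf_neq0.
set x := _ / _.
have : 8 * (b ^+ 2 - 3 * c) ^+ 3 * (x ^+ 3 + b * x ^+ 2 + c * x + e) =
   - (27 * e - 9 * b * c + 2 * b ^+ 3) * cubic_disc _ b c e.
  by rewrite /x /cubic_disc; field; rewrite n2 k0.
have K : 8 * (b ^+ 2 - 3 * c) ^+ 3 != 0 by rewrite mulf_neq0 ?expf_neq0.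
by rewrite D0 mulr0 => /eqP; rewrite mulf_eq0 (negbTE K) => /eqP.
Qed.

(** With a the leading coefficient, a^2 f(x) is a monic cubic g in a x, so g
    has a root modulo every prime too. The primes modulo which its
    discriminant D is a square have an unbounded sum of ln p / p, but away
    from 2 D they split g completely, which bounds the sum. *)
Lemma cubic_no_root_mod_some_prime (f : {poly int}) :
  irreducible_poly f -> size f = 4 ->
  ~ (forall p, prime p -> exists z, (p %| f.[z])%Z).
Proof.
move=> f_irr f_size H.
pose a := f`_3; pose b := f`_2; pose c := a * f`_1; pose e := a ^+ 2 * f`_0.
have fE z : a ^+ 2 * f.[z] = (a * z) ^+ 3 + b * (a * z) ^+ 2 + c * (a * z) + e.
  by rewrite horner_coef f_size !big_ord_recl big_ord0 /= /e /c /b /a /bump /=; ring.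
have fQE z : a%:~R ^+ 2 * (pZtoQ f).[z] =
   (a%:~R * z) ^+ 3 + b%:~R * (a%:~R * z) ^+ 2 + c%:~R * (a%:~R * z) + e%:~R.
  rewrite horner_coef size_rat_int_poly f_size !big_ord_recl big_ord0 /= !coef_map.
  by rewrite /e /c /b /a /bump /=; ring.
have a0 : a != 0.
  by have := lead_coef_eq0 f; rewrite lead_coefE f_size -/a => ->; rewrite -size_poly_eq0 f_size.
have noroot (y : rat) : y ^+ 3 + b%:~R * y ^+ 2 + c%:~R * y + e%:~R != 0.
  have aQ : (a%:~R : rat) != 0 by rewrite intr_eq0.
  have := @irreducible_noroot _ _ (y / a%:~R) (proj2 (irreducible_rat_int f) f_irr).
  rewrite size_rat_int_poly f_size => /(_ isT); apply: contraNneq => g0.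
  have := fQE (y / a%:~R); rewrite mulrCA divff // mulr1 g0 => /eqP.
  by rewrite mulf_eq0 expf_eq0 (negbTE aQ).
pose D := cubic_disc _ b c e.
have D0 : D != 0.
  apply/negP => /eqP D0.
  have [||| y yr] := @cubic_disc_eq0 rat b%:~R c%:~R e%:~R => //.
    have : D%:~R = 0 :> rat by rewrite D0.
    by move=> <-; rewrite /D /cubic_disc; ring.
  by move: (noroot y); rewrite yr eqxx.
pose g : {poly int} := 'X^3 + (b *: 'X^2 + c *: 'X + e%:P).
have gE z : g.[z] = z ^+ 3 + b * z ^+ 2 + c * z + e.
  by rewrite /g !(hornerD, hornerZ, hornerXn, hornerX, hornerC) !addrA.
have szD : (size (b *: 'X^2 + c *: 'X + e%:P : {poly int})%R < size ('X^3 : {poly int})%R)%N.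
  have sX n (k : int) : (n < 3)%N -> (size (k *: 'X^n : {poly int})%R <= 3)%N.
    by move=> n3; rewrite (leq_trans (size_scale_leq _ _)) // size_polyXn.
  have sD (u v : {poly int}) : (size u <= 3)%N -> (size v <= 3)%N -> (size (u + v)%R <= 3)%N.
    by move=> ? ?; rewrite (leq_trans (size_polyD _ _)) // geq_max; apply/andP.
  rewrite size_polyXn ltnS; apply: (sD); last by rewrite (leq_trans (size_polyC_leq1 _)).
  by apply: (sD); [exact: sX | exact: (sX 1%N)].
have g_size : size g = 4 by rewrite /g (size_polyDl szD) size_polyXn.
have g_monic : g \is monic by rewrite /g monicE (lead_coefDl szD) lead_coefXn.
have g_irr : irreducible_poly g.
  apply/irreducible_rat_int; apply: cubic_irreducible; first by rewrite size_rat_int_poly g_size.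
  move=> y; rewrite /root /g !rmorphD /= map_polyXn !map_polyZ /= map_polyXn map_polyX map_polyC /=.
  by rewrite !(hornerD, hornerZ, hornerXn, hornerX, hornerC) !addrA; exact: noroot.
have g_root p : prime p -> exists w, (p %| g.[w])%Z.
  move=> pp; have [z zf] := H p pp; exists (a * z).
  by rewrite gE -fE; exact: dvdz_mull.
pose res (p : nat) := `[< exists z : int, (p %| z ^+ 2 - D)%Z >].
pose m := `|(2 * D)%R|%N.
have m0 : (0 < m)%N by rewrite absz_gt0 mulf_neq0.
pose S p := res p && ~~ (p %| m)%N.
have g_split p : prime p -> S p -> exists s : 'I_3 -> int,
    (forall i j, i != j -> ~~ (p %| s i - s j)%Z) /\ (forall i, (p %| g.[s i])%Z).
  move=> pp /andP[/asboolP[z zD] pm]; have [r rg] := g_root p pp.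
  have p2 : ~~ (p %| 2)%N.
    by apply: contra pm => p2; rewrite /m abszM dvdn_mulr.
  have pD : ~~ (p %| D)%Z.
    by apply: contra pm; rewrite dvdzE /m abszM => h; rewrite dvdn_mull.
  rewrite gE in rg.
  have [s [s_inj s_root]] := cubic_split_mod p b c e r z pp p2 rg zD pD.
  by exists s; split=> // i; rewrite gE.
have [M MP] := split_sum_bounded R g 3 S g_monic g_size isT g_irr g_root g_split.
have resP p (z : int) : prime p -> (p %| z ^+ 2 - D)%Z -> res p.
  by move=> _ zD; apply/asboolP; exists z.
have [n nP] := sum_residue_unbounded D D0 R res resP (M + lnn m + 1).
have := sum_prime_split res m n m0; have := MP n; rewrite /S; lra.
Qed.

End NotIntersective.

(** * Values of polynomials modulo prime powers *)

Lemma eq0_modP (m x : int) : (x = 0 %[mod m])%Z <-> (m %| x)%Z.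
Proof. by rewrite mod0z; split=> /dvdz_mod0P. Qed.

Lemma dvdz_hornerB (H : {poly int}) (x y : int) : (x - y %| H.[x] - H.[y])%Z.
Proof.
have /factor_theorem[q E] : root (H - H.[y]%:P) y by rewrite /root !hornerE subrr.
have -> : H.[x] - H.[y] = (H - H.[y]%:P).[x] by rewrite !hornerE.
by rewrite E !hornerE dvdz_mull.
Qed.

Lemma dvdz_horner_mod (H : {poly int}) (d x y : int) :
  (x = y %[mod d])%Z -> (d %| H.[y])%Z -> (d %| H.[x])%Z.
Proof.
move/eqP; rewrite eqz_mod_dvd => /dvdz_trans/(_ (dvdz_hornerB H x y)) dB h.
by rewrite -(subrK H.[y] H.[x]) rpredD.
Qed.

Lemma poly_taylor2 (H : {poly int}) (x h : int) :
  exists r, H.[x + h] = H.[x] + h * H^`().[x] + h ^+ 2 * r.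
Proof.
elim/poly_ind: H => [|H c [r IH]]; first by exists 0; rewrite deriv0 !horner0; ring.
exists (H^`().[x] + r * (x + h)).
by rewrite derivMXaddC !hornerE /= IH; ring.
Qed.

(** The Chinese remainder theorem, removing one prime power from m at a
    time. *)
Lemma intersective_prime_powers (H : {poly int}) : intersective H <->
  forall p k, prime p -> exists n, ((p ^ k)%N %| H.[n])%Z.
Proof.
split=> [HI p k pp|HI m].
  have [n hn] := HI (p ^ k)%N ltac:(by rewrite expn_gt0 prime_gt0).
  by exists n; apply/eq0_modP.
suff L : (0 < m)%N -> exists n, (m %| H.[n])%Z.
  by move/L => [n hn]; exists n; apply/eq0_modP.
have [N] := ubnP m; elim: N m => // N IH m mN m0.
have [m1|m1] := leqP m 1.
  by exists 0; have -> : m = 1%N by lia.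
have pp := pdiv_prime m1; set p := pdiv m in pp.
have [m' pm' mE] := pfactor_coprime pp m0; set k := logn p m in mE.
have k0 : (0 < k)%N by rewrite /k logn_gt0 mem_primes pp m0 pdiv_dvd.
have m'0 : (0 < m')%N by move: m0; rewrite mE muln_gt0 => /andP[].
have [|n1 h1] := IH m' _ m'0.
  apply: (@leq_trans m) => //; rewrite mE -[ltnLHS]muln1 ltn_pmul2l //.
  by rewrite -[ltnLHS](expn0 p) ltn_exp2l // prime_gt1.
have [n2 h2] := HI p k pp.
have cop : coprimez m' (p ^ k)%N by rewrite coprimezE /= coprime_sym coprimeXl.
exists (zchinese m' (p ^ k)%N n1 n2).
rewrite mE PoszM Gauss_dvdz //; apply/andP; split.
  by apply: dvdz_horner_mod h1; apply: zchinese_modl.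
by apply: dvdz_horner_mod h2; apply: zchinese_modr.
Qed.

Lemma linear_polyE a b n : (linear_polyZ a b).[n] = a * n + b.
Proof. by rewrite /linear_polyZ !hornerE. Qed.

Lemma linear_root_mod (p k : nat) (a b : int) : prime p -> ~~ (p %| a)%Z ->
  exists n, ((p ^ k)%N %| (linear_polyZ a b).[n])%Z.
Proof.
move=> pp pa.
have /coprimezP[[u v] /= e] : coprimez a (p ^ k)%N.
  by rewrite coprimezE /= coprimeXr // coprime_sym prime_coprime.
exists (- u * b); rewrite linear_polyE.
have -> : a * (- u * b) + b = b * v * (p ^ k)%N.
  have -> : b * v * (p ^ k)%N%:Z = b * (v * (p ^ k)%N%:Z) by ring.
  have -> : v * (p ^ k)%N%:Z = 1 - u * a by rewrite -e; ring.
  by ring.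
by rewrite dvdz_mull.
Qed.

Lemma linear_primitive_ndvd (p : nat) (a b : int) : prime p ->
  primitive_polyZ (linear_polyZ a b) -> (p %| a)%Z -> ~~ (p %| b)%Z.
Proof.
move=> pp pr pa; apply/negP => pb.
have : (p%:Z %| zcontents (linear_polyZ a b))%Z.
  rewrite dvdz_contents; apply/polyOverP => i; rewrite /linear_polyZ coefD coefZ coefX coefC.
  by apply: rpredD; [exact: dvdz_mulr | case: eqP => _ //; exact: rpred0].
rewrite dvdzE (eqP pr) /= dvdn1 => /eqP p1.
by have := prime_gt1 pp; rewrite p1.
Qed.

(** The value is congruent to b modulo p, and p cannot divide both
    coefficients of a primitive form. *)
Lemma linear_ndvd_value (p k : nat) (a b n : int) : prime p ->
  primitive_polyZ (linear_polyZ a b) -> (p %| a)%Z ->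
  coprimez (p ^ k)%N (linear_polyZ a b).[n].
Proof.
move=> pp pr pa; rewrite coprimezE /= coprimeXl // prime_coprime // -(absz_nat p) -dvdzE.
apply: contra (linear_primitive_ndvd p a b pp pr pa); rewrite linear_polyE => h.
by rewrite -(addKr (a * n) b) rpredD // rpredN dvdz_mulr.
Qed.

Lemma eq_upto_sign_dvd (f g : {poly int}) (d n : int) : eq_upto_sign f g ->
  (d %| f.[n])%Z = (d %| g.[n])%Z.
Proof. by case/orP=> /eqP->; rewrite ?hornerN ?rpredN. Qed.

Lemma eq_upto_sign_intersective (f g : {poly int}) : eq_upto_sign f g ->
  intersective f -> intersective g.
Proof.
move=> fg fI m m0; have [n /eq0_modP h] := fI m m0; exists n; apply/eq0_modP.
by rewrite -(eq_upto_sign_dvd _ _ _ _ fg).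
Qed.

Lemma eq_upto_sign_size (f g : {poly int}) : eq_upto_sign f g -> size f = size g.
Proof. by case/orP=> /eqP->; rewrite ?size_polyN. Qed.

(** * Roots in the p-adic integers *)

Lemma padic_modulusE p k : prime p -> padic_modulus p k = p%:Z ^+ k.
Proof. by move=> pp; rewrite /padic_modulus Zp_cast // prime_gt1. Qed.

Lemma padic_intr p (c : int) k : ((c%:~R : padic_int p) k = c %[mod padic_modulus p k])%Z.
Proof.
have P (n : nat) : ((n%:R : padic_int p) k = n%:Z %[mod padic_modulus p k])%Z.
  elim: n => [|n IH]; first by rewrite /= modz_mod.
  by rewrite -natr1 /= modz_mod -modzDml IH modzDml -modzDmr modz_mod modzDmr -addn1 PoszD.
case: c => n; first exact: P.
by rewrite NegzE rmorphN /= modz_mod -modzNm P modzNm.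
Qed.

Lemma padic_horner p (Q : {poly int}) (z : padic_int p) k :
  ((map_poly intr Q).[z] k = Q.[z k] %[mod padic_modulus p k])%Z.
Proof.
elim/poly_ind: Q => [|Q c IH]; first by rewrite rmorph0 !horner0 /= modz_mod.
rewrite rmorphD rmorphM /= map_polyX map_polyC /= !hornerMXaddC /=.
rewrite !modz_mod modzDml -modzDm -modzMml IH modzMml padic_intr modzDm.
by [].
Qed.

Lemma padic_root_mod p (Q : {poly int}) k : prime p -> has_padic_root p Q ->
  exists n, ((p ^ k)%N %| Q.[n])%Z.
Proof.
move=> pp [z /rootP zr]; exists (z k); apply/eq0_modP.
have := padic_horner p Q z k; rewrite padic_modulusE // PoszX => <-.
by rewrite zr /= -(padic_modulusE _ _ pp) modz_mod.
Qed.

(** Newton's step: as p^t exactly divides Q'(x), the correction h =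
    p^(t+k+1) y changes Q(x) by h Q'(x) modulo p^(2t+k+2), and y is chosen
    to cancel the lowest nonzero digit of Q(x). *)
Lemma hensel_step (p : nat) (Q : {poly int}) (t k : nat) (x : int) : prime p ->
  (p%:Z ^+ (2 * t + k.+1) %| Q.[x])%Z ->
  (p%:Z ^+ t %| Q^`().[x])%Z -> ~~ (p%:Z ^+ t.+1 %| Q^`().[x])%Z ->
  exists x', [/\ (p%:Z ^+ (2 * t + k.+2) %| Q.[x'])%Z,
    (p%:Z ^+ t %| Q^`().[x'])%Z, ~~ (p%:Z ^+ t.+1 %| Q^`().[x'])%Z &
    (x = x' %[mod p%:Z ^+ k])%Z].
Proof.
move=> pp /dvdzP[q qE] /dvdzP[d dE] nd.
have pd : ~~ (p %| d)%Z.
  by apply: contra nd => /dvdzP[d' d'E]; rewrite dE d'E exprS -mulrA dvdz_mull.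
have /coprimezP[[u v] /= uv] : coprimez d p.
  by rewrite coprimezE coprime_sym prime_coprime.
pose T : int := p%:Z ^+ t; pose K : int := p%:Z ^+ k.
have E1 : p%:Z ^+ (2 * t + k.+1) = T * T * K * p%:Z.
  by rewrite mul2n -addnn !exprD exprSr /T /K; ring.
have E2 : p%:Z ^+ (2 * t + k.+2) = T * T * K * p%:Z * p%:Z.
  by rewrite mul2n -addnn !exprD !exprSr /T /K; ring.
(* u being the inverse of d modulo p, q + d (- u q) is divisible by p. *)
pose h := T * K * p%:Z * (- u * q).
have hT : (p%:Z ^+ t.+1 %| h)%Z.
  by apply/dvdzP; exists (K * (- u * q)); rewrite exprSr -/T /h; ring.
have dB : (p%:Z ^+ t.+1 %| Q^`().[x + h] - Q^`().[x])%Z.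
  by apply: (dvdz_trans hT); have := dvdz_hornerB Q^`() (x + h) x; rewrite addrAC subrr add0r.
have tS : (p%:Z ^+ t %| p%:Z ^+ t.+1)%Z by rewrite dvdz_exp2l.
exists (x + h); split.
- have [r rE] := poly_taylor2 Q x h.
  apply/dvdzP; exists (q * v + K * (u * q) ^+ 2 * r).
  have vE : v * p%:Z = 1 - u * d by rewrite -uv; ring.
  rewrite rE qE dE E1 E2 -/T.
  have -> : (q * v + K * (u * q) ^+ 2 * r) * (T * T * K * p * p) =
     q * (v * p%:Z) * (T * T * K * p) + K * (u * q) ^+ 2 * r * (T * T * K * p * p) by ring.
  by rewrite vE /h; ring.
- have -> : Q^`().[x + h] = (Q^`().[x + h] - Q^`().[x]) + Q^`().[x] by ring.
  by rewrite rpredD ?(dvdz_trans tS dB) // dE dvdz_mull.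
- apply: contra nd => d1.
  have -> : Q^`().[x] = Q^`().[x + h] - (Q^`().[x + h] - Q^`().[x]) by ring.
  by rewrite rpredB.
apply/eqP; rewrite eqz_mod_dvd opprD addrA subrr add0r rpredN.
by apply/dvdzP; exists (T * p%:Z * (- u * q)); rewrite -/K /h; ring.
Qed.

(** The identity r = u Q + v Q' shows that the exponent t of p in Q'(x) is
    at most s, so that p^(2t+1) divides Q(x) and the Newton iteration can
    start. *)
Lemma hensel_padic_root (p s : nat) (Q u v : {poly int}) (r x : int) : prime p ->
  r%:P = u * Q + v * Q^`() -> ~~ (p%:Z ^+ s.+1 %| r)%Z ->
  (p%:Z ^+ (2 * s + 1) %| Q.[x])%Z -> has_padic_root p Q.
Proof.
move=> pp rE nr Qx.
have nQ' : ~~ (p%:Z ^+ s.+1 %| Q^`().[x])%Z.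
  apply: contra nr => d.
  have -> : r = u.[x] * Q.[x] + v.[x] * Q^`().[x].
    by have := congr1 (fun q => q.[x]) rE; rewrite !hornerE.
  apply: rpredD; last exact: dvdz_mull.
  by apply: dvdz_mull; apply: dvdz_trans Qx; rewrite dvdz_exp2l //; lia.
have [t [ts dt ndt]] : exists t, [/\ (t <= s)%N, (p%:Z ^+ t %| Q^`().[x])%Z &
    ~~ (p%:Z ^+ t.+1 %| Q^`().[x])%Z].
  elim: s nQ' {nr Qx} => [|s IH] n; first by exists 0%N; rewrite expr0 dvd1z.
  have [d|nd] := boolP (p%:Z ^+ s.+1 %| Q^`().[x])%Z; first by exists s.+1.
  by have [t [ts dt ndt]] := IH nd; exists t; split=> //; apply: leqW.
pose ok k x := [/\ (p%:Z ^+ (2 * t + k.+1) %| Q.[x])%Z,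
    (p%:Z ^+ t %| Q^`().[x])%Z & ~~ (p%:Z ^+ t.+1 %| Q^`().[x])%Z].
have step k (y : {y | ok k y}) :
    {y' : {y' | ok k.+1 y'} | (sval y = sval y' %[mod p%:Z ^+ k])%Z}.
  case: y => y [h1 h2 h3]; have [y' [? ? ? ?]] := cid (hensel_step p Q t k y pp h1 h2 h3).
  have y'P : ok k.+1 y' by [].
  by exists (exist _ y' y'P).
have ok0 : ok 0%N x.
  by split=> //; apply: dvdz_trans Qx; rewrite dvdz_exp2l //; lia.
pose y : forall k, {y | ok k y} :=
  fix y k := if k is k'.+1 then sval (step k' (y k')) else exist _ x ok0.
have yP k : (sval (y k) = sval (y k.+1) %[mod padic_modulus p k])%Z.
  by rewrite padic_modulusE //; exact: (svalP (step k (y k))).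
exists (padic_reduce (f := fun k => sval (y k)) yP); apply/rootP.
apply: padic_ext => k; rewrite padic_horner /= modz_mod mod0z; apply/dvdz_mod0P.
apply: (@dvdz_horner_mod _ _ _ (sval (y k))); first by rewrite modz_mod.
have [d _ _] := svalP (y k); rewrite padic_modulusE //.
have kk : (k <= 2 * t + k.+1)%N by rewrite ltnW // leq_addl.
exact: dvdz_trans (dvdz_exp2l _ kk) d.
Qed.

Lemma padic_root_iff (p : nat) (Q : {poly int}) : prime p ->
  irreducible_poly Q -> (2 < size Q)%N ->
  has_padic_root p Q <->
  exists x : int, (Q.[x] = 0 %[mod (p ^ (2 * resultant_val p Q + 1))%N])%Z.
Proof.
move=> pp Q_irr Q2; split=> [h|[x /eq0_modP hx]].
  have [n hn] := padic_root_mod p Q (2 * resultant_val p Q + 1) pp h.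
  by exists n; apply/eq0_modP.
have Q'1 : (1 < size Q^`())%N.
  rewrite ltnNge; apply/negP => /leq_sizeP/(_ (size Q).-2) => h.
  have e : (size Q).-2.+1 = (size Q).-1 by lia.
  have := h ltac:(lia); rewrite coef_deriv e -lead_coefE => /eqP.
  rewrite mulrn_eq0 /= lead_coef_eq0 => /orP[|/eqP Q0].
    by case: (size Q) Q2 => [|[|[|?]]].
  by rewrite Q0 size_poly0 in Q2.
have Q1 : (1 < size Q)%N by lia.
have [[u v] _ rE] := resultant_in_ideal Q1 Q'1.
have r0 : resultant Q Q^`() != 0.
  rewrite resultant_eq0 -leqNgt.
  have Q'0 : Q^`() != 0 by rewrite -size_poly_gt0; lia.
  have : coprimep Q Q^`().
    rewrite irreducible_poly_coprime //; apply/negP => /(dvdp_leq Q'0).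
    by rewrite leqNgt lt_size_deriv ?irredp_neq0.
  by rewrite /coprimep => /eqP->.
apply: (hensel_padic_root p (resultant_val p Q) Q u v _ x pp rE); last by rewrite -PoszX.
by rewrite dvdzE abszX pfactor_dvdn ?ltnn // absz_gt0.
Qed.

(** * Irreducible factors and the radical *)

(** Gauss's lemma: a divisor up to constants has an associate that is a
    divisor in Z[x]. *)
Lemma irreducible_polyZ_poly (f : {poly int}) :
  irreducible_polyZ f -> (1 < size f)%N -> irreducible_poly f.
Proof.
move=> [f0 _ f_irr] f1; split=> // q q1 /dvdpP_int[r fE].
have q0 : q != 0 by apply: contraNneq f0 => q0; rewrite fE q0 zprimitive0 mul0r.
have zq : zprimitive q %= q.
  by rewrite {2}[q]zpolyEprim eqp_sym eqp_scale // zcontents_eq0.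
have [gu|ru] := f_irr _ _ fE.
  move: gu; rewrite poly_unitE (eqp_size zq) => /andP[/eqP e _].
  by rewrite e in q1.
rewrite -(eqp_ltrans zq) fE; move: ru; rewrite poly_unitE => /andP[/size_poly1P[c c0 ->] _].
by rewrite mulrC mul_polyC eqp_sym eqp_scale.
Qed.

(** Polynomials proportional over Q have the same primitive part. *)
Lemma primitive_eqp (f g : {poly int}) : primitive_polyZ f -> primitive_polyZ g ->
  f %= g -> eq_upto_sign f g.
Proof.
have pE h : primitive_polyZ h -> eq_upto_sign h (zprimitive h).
  rewrite /primitive_polyZ /eq_upto_sign {2 4}[h]zpolyEprim; case: (zcontents h) => [[|[|n]]|[|n]] //= _.
    by rewrite scale1r eqxx.
  by rewrite NegzE scaleN1r eqxx orbT.
move=> pf pg /eqpP[[c1 c2] /= /andP[c10 c20] e].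
have ez : zprimitive f = zprimitive g.
  by rewrite -(zprimitiveZ _ c10) e zprimitiveZ.
move: (pE f pf) (pE g pg); rewrite ez; move: (zprimitive g) => z.
by rewrite /eq_upto_sign => /orP[]/eqP-> /orP[]/eqP->; rewrite ?opprK ?eqxx ?orbT.
Qed.

Lemma zcontentsC (c : int) : zcontents c%:P = c.
Proof. by rewrite -alg_polyC zcontentsZ (zcontents_monic (monic1 _)) mulr1. Qed.

Lemma primitive_const_unit (g h : {poly int}) : primitive_polyZ (g * h) ->
  size g = 1%N -> g \is a GRing.unit.
Proof.
move=> pr g1; have [c c0 gE] := size_poly1P g (introT eqP g1).
move: pr; rewrite /primitive_polyZ zcontentsM abszM muln_eq1 gE zcontentsC => /andP[cu _].
by rewrite poly_unitE size_polyC c0 coefC eqxx; case: c cu {c0 gE} => [[|[|?]]|[|?]].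
Qed.

(** The primitive part of a nonconstant divisor of least degree. *)
Lemma exists_radical_factor (P : {poly int}) : (1 < size P)%N ->
  exists f, radical_factor P f.
Proof.
have [N] := ubnP (size P); elim: N P => // N IH P PN P1.
have P0 : P != 0 by rewrite -size_poly_gt0; lia.
have [[q [q1 qP qd]]|noq] := pselect (exists q : {poly int},
    [/\ (1 < size q)%N, (size q < size P)%N & q %| P]).
  have zs : size (zprimitive q) = size q by rewrite size_zprimitive.
  have [r PE] := dvdpP_int qd.
  have [||f [f1 pf irf [g gE]]] := IH (zprimitive q); rewrite ?zs //.
    exact: leq_trans qP PN.
  by exists f; split=> //; exists (g * r); rewrite PE gE mulrA.
have zs : size (zprimitive P) = size P by rewrite size_zprimitive.
have zpr : primitive_polyZ (zprimitive P).
  by rewrite /primitive_polyZ zcontents_primitive P0.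
have zdvd (g h : {poly int}) : zprimitive P = g * h -> g %| P.
  by move=> e; rewrite [P]zpolyEprim e scalerAr dvdp_mulr.
exists (zprimitive P); split; rewrite ?zs //; last first.
  by exists (zcontents P)%:P; rewrite mulrC mul_polyC -zpolyEprim.
split=> [||g h e]; first by rewrite zprimitive_eq0.
  by rewrite poly_unitE zs; apply/negP => /andP[/eqP e]; rewrite e in P1.
have gh0 : g * h != 0 by rewrite -e zprimitive_eq0.
have [g0 h0] : g != 0 /\ h != 0 by move: gh0; rewrite mulf_eq0 negb_or => /andP.
have [/eqP g1|g1] := eqVneq (size g) 1%N.
  by left; apply: (primitive_const_unit g h); [rewrite -e | exact/eqP].
right; apply: (primitive_const_unit h g); first by rewrite mulrC -e.
have gs : (1 < size g)%N by rewrite ltn_neqAle eq_sym g1 size_poly_gt0.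
have hs : (0 < size h)%N by rewrite size_poly_gt0.
have sz : size P = (size g + size h).-1 by rewrite -zs e size_mul.
apply/eqP; rewrite eqn_leq hs andbT leqNgt; apply/negP => h1.
by apply: noq; exists g; split=> //; [rewrite sz; lia | exact: (zdvd g h)].
Qed.

(** Split off irreducible factors of P one at a time, each of them dividing
    R; what remains is a constant. *)
Lemma radical_power (P R : {poly int}) : P != 0 ->
  (forall f, radical_factor P f -> exists g, R = f * g) ->
  exists (c : int) k h, c != 0 /\ c *: R ^+ k = P * h.
Proof.
have [N] := ubnP (size P); elim: N P => // N IH P PN P0 PR.
have [P1|P1] := leqP (size P) 1.
  have [c c0 ->] : exists2 c, c != 0 & P = c%:P.
    by apply/size_poly1P; rewrite eqn_leq P1 size_poly_gt0.
  by exists c, 0%N, 1; rewrite expr0 mulr1 alg_polyC.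
have [f rf] := exists_radical_factor P P1.
have [f1 _ _ [P' PE]] := rf.
have P'0 : P' != 0 by apply: contraNneq P0 => e; rewrite PE e mulr0.
have f0 : f != 0 by rewrite -size_poly_gt0; lia.
have [||c [k [h [c0 e]]]] := IH P' _ P'0.
- by move: PN f1; rewrite PE size_mul //; move: (size f) (size P') => x y; lia.
- move=> g [g1 pg ig [q qE]]; apply: PR; split=> //.
  by exists (f * q); rewrite PE qE mulrCA.
have [g RE] := PR f rf.
exists c, k.+1, (h * g); split=> //.
by rewrite exprSr scalerAl e {1}RE PE; ring.
Qed.

Lemma prod_dvd_exp (s : seq {poly int}) (P : {poly int}) :
  (forall f, f \in s -> exists g, P = f * g) ->
  exists h, P ^+ size s = (\prod_(f <- s) f) * h.
Proof.
elim: s => [|f s IH] sP; first by exists 1; rewrite big_nil expr0 mulr1.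
have [g PE] := sP f (mem_head _ _).
have [|h hE] := IH; first by move=> f' f's; apply: sP; rewrite inE f's orbT.
by exists (g * h); rewrite big_cons /= exprS hE {1}PE; ring.
Qed.

(** Irreducible primitive polynomials that are not associate are coprime
    over Q. *)
Lemma prod_coprime_dvdp (s : seq {poly int}) (P : {poly int}) :
  (forall f, f \in s -> radical_factor P f) ->
  pairwise (fun f g => ~~ eq_upto_sign f g) s ->
  \prod_(f <- s) f %| P.
Proof.
elim: s => [|f s IH] sP; first by rewrite big_nil dvd1p.
rewrite /= => /andP[/allP fs ps]; rewrite big_cons.
have [f1 pf irf [g PE]] := sP f (mem_head _ _).
have sP' f' : f' \in s -> radical_factor P f'.
  by move=> f's; apply: sP; rewrite inE f's orbT.
have f_irr := irreducible_polyZ_poly f irf f1.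
rewrite Gauss_dvdp ?IH //; first by rewrite PE dvdp_mulr.
rewrite big_seq; apply: (big_ind (fun q => coprimep f q)); first exact: coprimep1.
  by move=> x y cx cy; rewrite coprimepMr cx.
move=> h hs; have [h1 ph irh _] := sP' h hs.
rewrite irreducible_poly_coprime //; apply: contra (fs h hs) => fh.
apply: primitive_eqp => //; apply: (apply_irredp (irreducible_polyZ_poly h irh h1)) => //.
by rewrite neq_ltn f1 orbT.
Qed.

Section Radical.
Variables (P R : {poly int}).
Hypotheses (P0 : P != 0) (PR : squarefree_radical P R).

(** If P divides c R^k, a zero of P modulo c m^(k+1) is a zero of c R^(k+1),
    hence R vanishes modulo m. Conversely R divides a power of P. *)
Lemma radical_intersective : intersective P <-> intersective R.
Proof.
have [s [sP s_pw sall RE]] := PR.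
have sR f : f \in s -> exists g, R = f * g.
  move=> fs; case/orP: RE => /eqP->; rewrite (perm_big _ (perm_to_rem fs)) big_cons /=.
    by eexists.
  by eexists; rewrite -mulrN.
split=> [PI|RI] m m0.
  have [|c [k [h [c0 e]]]] := radical_power P R P0.
    move=> f /sall[g gs /orP[]/eqP fg]; have [q ->] := sR g gs; rewrite fg; first by eexists.
    by exists (- q); rewrite mulrNN.
  have [|n /eq0_modP hn] := PI (`|c| * m ^ k.+1)%N.
    by rewrite muln_gt0 absz_gt0 c0 expn_gt0 m0.
  exists n; apply/eq0_modP.
  have : ((`|c| * m ^ k.+1)%N%:Z %| c * R.[n] ^+ k.+1)%Z.
    have -> : c * R.[n] ^+ k.+1 = (c *: R ^+ k * R).[n] by rewrite !hornerE exprSr mulrA.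
    by rewrite e !hornerM dvdz_mulr // dvdz_mulr.
  by rewrite !dvdzE !absz_nat abszM abszX dvdn_pmul2l ?absz_gt0 // dvdn_pexp2r.
have [h hE] := prod_dvd_exp s P (fun f fs => let: And4 _ _ _ g := sP f fs in g).
have [|n hn] := RI (m ^ (size s).+1)%N; first by rewrite expn_gt0 m0.
exists n; apply/eq0_modP; move/eq0_modP: hn; rewrite (eq_upto_sign_dvd _ _ _ _ RE) => hn.
have : ((m ^ (size s).+1)%N%:Z %| P.[n] ^+ (size s).+1)%Z.
  by rewrite -horner_exp exprS hE !hornerM mulrCA dvdz_mulr.
by rewrite !dvdzE !absz_nat abszX dvdn_pexp2r.
Qed.

(** A product of pairwise coprime divisors of P divides P over Q. *)
Lemma size_radical : (size R <= size P)%N.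
Proof.
have [s [sP s_pw _ RE]] := PR.
rewrite (eq_upto_sign_size _ _ RE); apply: dvdp_leq => //.
exact: prod_coprime_dvdp.
Qed.

End Radical.

(** * Intersective radicals *)

Lemma irreducible_not_intersective (f : {poly int}) :
  irreducible_polyZ f -> (2 < size f <= 4)%N -> ~ intersective f.
Proof.
move=> f_irr /andP[f2 f4] fI.
have f_irr' : irreducible_poly f by apply: irreducible_polyZ_poly => //; lia.
have roots p : prime p -> exists z, (p %| f.[z])%Z.
  by move=> pp; have [n /eq0_modP h] := fI p (prime_gt0 pp); exists n.
have [f3|f3] : (size f = 3 \/ size f = 4)%N by lia.
  exact: (quadratic_no_root_mod_some_prime Rdefinitions.R f f_irr' f3 roots).
exact: (cubic_no_root_mod_some_prime Rdefinitions.R f f_irr' f3 roots).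
Qed.

Lemma size2_linear (f : {poly int}) : size f = 2 ->
  f`_1 != 0 /\ f = linear_polyZ f`_1 f`_0.
Proof.
move=> f2; split.
  have : lead_coef f != 0 by rewrite lead_coef_eq0 -size_poly_eq0 f2.
  by rewrite lead_coefE f2.
apply/polyP => i; rewrite /linear_polyZ coefD coefZ coefX coefC.
case: i => [|[|i]] /=; rewrite ?mulr0 ?mulr1 ?add0r ?addr0 //.
by rewrite nth_default // f2.
Qed.

Lemma linear_prod_splits (I : Type) (r : seq I) (a b : I -> int) (f : {poly int}) :
  (forall i, a i != 0) ->
  eq_upto_sign f (\prod_(i <- r) linear_polyZ (a i) (b i)) -> splits_over_rat f.
Proof.
move=> a0 fE; exists [seq - ((b i)%:~R / (a i)%:~R) | i <- r].
have /eqp_ltrans-> : pZtoQ f %= pZtoQ (\prod_(i <- r) linear_polyZ (a i) (b i)).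
  case/orP: fE => /eqP->; first exact: eqpxx.
  by rewrite rmorphN /= -scaleN1r eqp_scale // oppr_eq0 oner_eq0.
rewrite big_map rmorph_prod; elim: r {fE} => [|i r IH]; first by rewrite !big_nil eqpxx.
rewrite !big_cons; apply: eqp_trans (eqp_mull _ IH); apply: eqp_mulr.
have aQ : ((a i)%:~R : rat) != 0 by rewrite intr_eq0.
rewrite /linear_polyZ rmorphD /= map_polyZ map_polyX map_polyC /=.
have -> : (a i)%:~R *: 'X + ((b i)%:~R)%:P =
  (a i)%:~R *: ('X - (- ((b i)%:~R / (a i)%:~R))%:P) :> {poly rat}.
  by rewrite scalerBr -[in RHS]mul_polyC -[in X in _ - X]mul_polyC -polyCM mulrN polyCN opprK mulrCA divff // mulr1 mul_polyC.
by rewrite eqp_scale.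
Qed.

Lemma gcd_linear_intersective r (a b : 'I_r -> int) (R : {poly int}) :
  eq_upto_sign R (\prod_(i < r) linear_polyZ (a i) (b i)) ->
  \big[gcdn/0%N]_(i < r) `|a i|%N = 1%N -> intersective R.
Proof.
move=> RE g1; apply/intersective_prime_powers => p k pp.
have [i pi] : exists i, ~~ (p %| a i)%Z.
  apply: contrapT => none; have : (p %| \big[gcdn/0%N]_(i < r) `|a i|%N)%N.
    apply/dvdn_biggcdP => i _; rewrite -[(_ %| _)%N]negbK -(absz_nat p) -dvdzE.
    by apply/negP => pi; apply: none; exists i.
  by rewrite g1 Euclid_dvd1.
have [n hn] := linear_root_mod p k _ (b i) pp pi; exists n.
by rewrite (eq_upto_sign_dvd _ _ _ _ RE) (bigD1 i) //= hornerM dvdz_mulr.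
Qed.

(** Modulo a prime dividing all the leading coefficients, every factor is a
    nonzero constant. *)
Lemma intersective_gcd_linear r (a b : 'I_r -> int) (R : {poly int}) :
  (forall i, primitive_polyZ (linear_polyZ (a i) (b i))) ->
  eq_upto_sign R (\prod_(i < r) linear_polyZ (a i) (b i)) ->
  intersective R -> \big[gcdn/0%N]_(i < r) `|a i|%N = 1%N.
Proof.
move=> pr RE RI; apply/eqP; apply: contraT => g1.
set g := \big[gcdn/0%N]_(i < r) _ in g1.
have [p pp pg] : exists2 p, prime p & (p %| g)%N.
  have [->|g0] := posnP g; first by exists 2%N.
  by exists (pdiv g); [rewrite pdiv_prime // ltn_neqAle eq_sym g1 | exact: pdiv_dvd].
have [n /eq0_modP] := RI p (prime_gt0 pp).
rewrite (eq_upto_sign_dvd _ _ _ _ RE) horner_prod.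
have cop : coprimez p (\prod_(i < r) (linear_polyZ (a i) (b i)).[n]).
  apply: (big_ind (fun x => coprimez p x : Prop)); first by rewrite coprimezE coprimen1.
    by move=> x y cx cy; rewrite coprimezMr cx.
  move=> i _; have := linear_ndvd_value p 1 (a i) (b i) n pp (pr i); rewrite expn1; apply.
  by rewrite dvdzE; move/dvdn_biggcdP: pg; apply.
move=> d; move: cop; rewrite coprimezE prime_coprime //.
by rewrite -(absz_nat p) -dvdzE d.
Qed.

Lemma linear_quadratic_intersective (R Q : {poly int}) (a b : int) :
  eq_upto_sign R (linear_polyZ a b * Q) ->
  (forall p : nat, prime p -> (p %| a)%Z -> has_padic_root p Q) -> intersective R.
Proof.
move=> RE H; apply/intersective_prime_powers => p k pp.
have [pa|pa] := boolP (p %| a)%Z.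
  have [n hn] := padic_root_mod p Q k pp (H p pp pa); exists n.
  by rewrite (eq_upto_sign_dvd _ _ _ _ RE) hornerM dvdz_mull.
have [n hn] := linear_root_mod p k a b pp pa; exists n.
by rewrite (eq_upto_sign_dvd _ _ _ _ RE) hornerM dvdz_mulr.
Qed.

(** For p dividing a, the linear factor is prime to p, so that the powers of
    p dividing values of R divide values of Q. *)
Lemma linear_quadratic_padic (R Q : {poly int}) (a b : int) :
  linear_quadratic R a b Q -> intersective R ->
  forall p : nat, prime p -> (p %| a)%Z -> has_padic_root p Q.
Proof.
move=> [_ prL [_ Q_irr Q3] RE] /intersective_prime_powers RI p pp pa.
have Q_irr' : irreducible_poly Q by apply: irreducible_polyZ_poly; rewrite ?Q3.
have Q2 : (2 < size Q)%N by rewrite Q3.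
apply/(padic_root_iff p Q pp Q_irr' Q2).
have [n] := RI p (2 * resultant_val p Q + 1)%N pp.
rewrite (eq_upto_sign_dvd _ _ _ _ RE) hornerM mulrC Gauss_dvdzl; last first.
  exact: linear_ndvd_value.
by move=> hn; exists n; apply/eq0_modP.
Qed.

(** A factor of degree 2 or 3 of R cannot stand alone, by
    irreducible_not_intersective; as the degree of R is at most 3, either
    all the factors are linear, or there are a quadratic and a linear one. *)
Lemma radical_shape (P R : {poly int}) : P != 0 -> (size P <= 4)%N ->
  squarefree_radical P R -> intersective R ->
  (exists (r : nat) (a b : 'I_r -> int),
     [/\ (1 <= r <= 3)%N,
         forall i, a i != 0 /\ primitive_polyZ (linear_polyZ (a i) (b i)) &
         eq_upto_sign R (\prod_(i < r) linear_polyZ (a i) (b i))])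
  \/ (exists (a b : int) (Q : {poly int}), linear_quadratic R a b Q).
Proof.
move=> P0 P4 PR RI.
have R4 : (size R <= 4)%N := leq_trans (size_radical P R P0 PR) P4.
have [s [sP _ _ RE]] := PR.
have sizeR := eq_upto_sign_size _ _ RE.
have prod_nz (t : seq {poly int}) : {subset t <= s} -> \prod_(f <- t) f != 0.
  move=> ts; rewrite prodf_seq_neq0; apply/allP => f /ts/sP[f1 _ _ _] /=.
  by rewrite -size_poly_gt0 ltnW.
have size_cons_prod f (t : seq {poly int}) : f \in s -> {subset t <= s} ->
    size (\prod_(g <- f :: t) g)%R = (size f + (size (\prod_(g <- t) g)%R).-1)%N.
  move=> fs ts; have [f1 _ _ _] := sP f fs.
  have t0 := prod_nz t ts; rewrite big_cons size_mul //; last by rewrite -size_poly_gt0 ltnW.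
  by rewrite (polySpred t0) addnS.
have [/allP s2|] := boolP (all (fun f : {poly int} => size f == 2) s).
  left; exists (size s).
  exists (fun i : 'I_(size s) => (s`_i)`_1), (fun i : 'I_(size s) => (s`_i)`_0).
  have sE (i : 'I_(size s)) := size2_linear _ (eqP (s2 _ (mem_nth 0 (ltn_ord i)))).
  have prodE : \prod_(i < size s) linear_polyZ (s`_i)`_1 (s`_i)`_0 = \prod_(f <- s) f.
    by rewrite (big_nth 0) big_mkord; apply: eq_bigr => i _; rewrite -(sE i).2.
  split; last by rewrite prodE.
    have sizeE : (size s = (size R).-1)%N.
      rewrite sizeR; suff : forall t : seq {poly int}, {subset t <= s} ->
          (size t = (size (\prod_(g <- t) g)%R).-1)%N by apply.
      elim=> [|f t IH] ts; first by rewrite big_nil size_poly1.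
      have fs : f \in s by apply: ts; rewrite mem_head.
      have ts' : {subset t <= s} by move=> g gt; apply: ts; rewrite inE gt orbT.
      by rewrite size_cons_prod // (eqP (s2 f fs)) -(IH ts').
    apply/andP; split; last by rewrite sizeE; move: R4; case: (size R) => [|[|[|[|[|]]]]].
    rewrite lt0n size_eq0; apply: contraPneq RI => s0 RI.
    have [n /eq0_modP] := RI 2%N isT.
    by rewrite (eq_upto_sign_dvd _ _ _ _ RE) s0 big_nil hornerC.
  move=> i; rewrite -(sE i).2; split; first exact: (sE i).1.
  by have [_ pr _ _] := sP _ (mem_nth 0 (ltn_ord i)).
move=> /allPn[f fs f2]; right.
have [f1 prf irf _] := sP f fs.
have perm_s := perm_to_rem fs.
have rem_s : {subset rem f s <= s} by move=> g; exact: mem_rem.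
have RE' : eq_upto_sign R (f * \prod_(g <- rem f s) g).
  by move: RE; rewrite (perm_big _ perm_s) big_cons.
have szR : size R = (size f + (size (\prod_(g <- rem f s) g)%R).-1)%N.
  by rewrite -(size_cons_prod _ _ fs rem_s) big_cons; apply: eq_upto_sign_size.
have f3 : (2 < size f)%N by rewrite ltn_neqAle eq_sym f2.
case E: (rem f s) => [|g t] in RE' szR rem_s.
  case: (irreducible_not_intersective f irf).
    by rewrite f3 -(leq_add2r 0) addn0 (leq_trans _ R4) // szR leq_addr.
  by apply: eq_upto_sign_intersective RI; rewrite big_nil mulr1 in RE'.
have gs : g \in s by apply: rem_s; rewrite mem_head.
have ts : {subset t <= s} by move=> h ht; apply: rem_s; rewrite inE ht orbT.
have [g1 prg irg _] := sP g gs.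
rewrite (size_cons_prod _ _ gs ts) in szR.
have t0 : (0 < size (\prod_(h <- t) h)%R)%N by rewrite size_poly_gt0 prod_nz.
have [sf [sg st]] : size f = 3 /\ size g = 2 /\ size (\prod_(h <- t) h)%R = 1%N.
  move: R4 f3 g1 t0; rewrite szR; move: (size f) (size g) (size (\prod_(h <- t) h)%R) => x y z; lia.
have tnil : t = [::].
  case: t ts {RE' E rem_s szR t0} st => // h t hts.
  have hs : h \in s by apply: hts; rewrite mem_head.
  have ts' : {subset t <= s} by move=> h' h't; apply: hts; rewrite inE h't orbT.
  have [h1 _ _ _] := sP h hs.
  by rewrite (size_cons_prod _ _ hs ts') => e; move: h1; rewrite -(leq_add2r (size (\prod_(j <- t) j)%R).-1) e.
have [a0 gE] := size2_linear g sg.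
exists g`_1, g`_0, f; split; rewrite -?gE //.
  by rewrite szR sf sg st.
by move: RE'; rewrite tnil big_cons big_nil mulr1 mulrC.
Qed.

Theorem proposition5p2 (P R : {poly int}) :
  P != 0 -> (size P <= 4)%N -> squarefree_radical P R ->
  (intersective P <->
     (splits_over_rat R /\
      exists (r : nat) (a b : 'I_r -> int),
        [/\ (1 <= r <= 3)%N,
            forall i, a i != 0 /\ primitive_polyZ (linear_polyZ (a i) (b i)),
            eq_upto_sign R (\prod_(i < r) linear_polyZ (a i) (b i))
          & \big[gcdn/0%N]_(i < r) `|a i|%N = 1%N])
     \/
     (exists (a b : int) (Q : {poly int}),
        linear_quadratic R a b Q /\
        (forall p : nat, prime p -> (p %| a)%Z -> has_padic_root p Q)))
  /\
  (forall (a b : int) (Q : {poly int}), linear_quadratic R a b Q ->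
     (forall p : nat, prime p -> (p %| a)%Z -> has_padic_root p Q)
     <->
     (forall p : nat, prime p -> (p %| a)%Z ->
        exists x : int,
          (Q.[x] = 0 %[mod (p ^ (2 * resultant_val p Q + 1))%N])%Z)).
Proof.
move=> P0 P4 PR; split; last first.
  move=> a b Q [_ _ [_ Q_irr Q3] _].
  have Q_irr' : irreducible_poly Q by apply: irreducible_polyZ_poly; rewrite ?Q3.
  have Q2 : (2 < size Q)%N by rewrite Q3.
  by split=> H p pp pa; apply/(padic_root_iff p Q pp Q_irr' Q2); exact: H.
rewrite (radical_intersective P R P0 PR); split=> [RI|].
  have [[r [a [b [r3 ab RE]]]]|[a [b [Q LQ]]]] := radical_shape P R P0 P4 PR RI.
    left; split; first by apply: linear_prod_splits RE => i; exact: (ab i).1.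
    exists r, a, b; split=> //.
    by apply: intersective_gcd_linear RE RI => i; exact: (ab i).2.
  right; exists a, b, Q; split=> //.
  exact: linear_quadratic_padic LQ RI.
case=> [[_ [r [a [b [_ _ RE g1]]]]]|[a [b [Q [[_ _ _ RE] H]]]]].
  exact: gcd_linear_intersective RE g1.
exact: linear_quadratic_intersective RE H.
Qed.
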